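(* Let $n\ge 2$. Then the Čech complex $\mathcal{N}(\mathbb{I}_n,2)$ is homotopy equivalent to a wedge sum of $2^{n-2}(n^2-3n+4)-1$ spheres of dimension $2$, i.e. \[\mathcal{N}(\mathbb{I}_n,2)\simeq \bigvee_{2^{n-2}(n^2-3n+4)-1}\mathbb{S}^2.\]
   Context: For a finite simple connected graph $G$ and a real number $r\ge 0$, the Čech complex $\mathcal{N}(G,r)$ is the simplicial complex with vertex set $V(G)$ in which a finite nonempty set $\sigma\subseteq V(G)$ is a simplex if and only if the closed balls of radius $\frac r2$ centered at the vertices of $\sigma$ have a common point. Here the balls are taken in the geometric realization of $G$, equipped with the shortest path metric in which each edge is isometric to the unit interval $[0,1]$. The $n$-dimensional hypercube graph $\mathbb{I}_n$ has vertex set $\{0,1\}^n$ (binary strings of length $n$), two vertices being adjacent if and only if they differ in exactly one coordinate. *)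

(* Defs.v *)
From HB Require Import structures.
From mathcomp Require Import all_boot all_order all_algebra.
From mathcomp Require Import all_classical reals.
From mathcomp Require Import topology normedtype homotopy.

Set Implicit Arguments.
Unset Strict Implicit.
Unset Printing Implicit Defensive.

Import Order.TTheory GRing.Theory Num.Theory.
Import numFieldNormedType.Exports.

Local Open Scope classical_set_scope.
Local Open Scope ring_scope.

Section homotopy_equivalence.
Variable R : realType.

Definition homotopic (X Y : topologicalType) (f g : X -> Y) : Prop :=
  exists H : X * R -> Y,
    [/\ {within [set: X] `*` `[0, 1], continuous H},
        forall x, H (x, 0) = f x
      & forall x, H (x, 1) = g x].

Definition homotopy_equivalent (X Y : topologicalType) : Prop :=
  exists (f : X -> Y) (g : Y -> X),
    [/\ continuous f, continuous g,
        homotopic (g \o f) idfun & homotopic (f \o g) idfun].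

Definition sphere_set (d : nat) : set 'rV[R]_d.+1 :=
  [set x | \sum_i x 0 i ^+ 2 = 1].
Arguments sphere_set : clear implicits.

Definition sphere (d : nat) : topologicalType := set_type (sphere_set d).

Lemma pole_subproof d : (delta_mx 0 0 : 'rV[R]_d.+1) \in sphere_set d.
Proof.
apply/mem_set; rewrite /sphere_set /= (bigD1 0) //= big1 => [|i /negPf i0].
  by rewrite !mxE eqxx expr1n addr0.
by rewrite mxE i0 andbF expr0n.
Qed.

Definition pole (d : nat) : sphere d := SigSub (pole_subproof d).

(* For k = 0 the library's quotient is the empty space, not a point. *)
Definition wedge_spheres (k d : nat) : topologicalType :=
  wedge (fun _ : 'I_k => pole d).

End homotopy_equivalence.

Record simplicial_complex (V : finType) := SimplicialComplex {
  face : set {set V};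
  face_neq0 : forall s, face s -> s != finset.set0;
  face_sub : forall s t : {set V},
    face s -> t != finset.set0 -> t \subset s -> face t;
  face_vertex : forall v, face [set v]%SET }.

Section realization.
Variables (R : realType) (V : finType) (K : simplicial_complex V).

(* Barycentric coordinates. As V is finite, the topology induced by R^V is the
   coherent topology. *)
Definition realization_set : set {ptws V -> R} :=
  [set x | [/\ forall v, 0 <= x v, \sum_v x v = 1
             & face K [set v | x v != 0]%SET]].

Definition realization : topologicalType := set_type realization_set.

Lemma vertex_subproof v :
  ((fun w => (w == v)%:R) : {ptws V -> R}) \in realization_set.
Proof.
apply/mem_set; split => [w||].
- exact: ler0n.
- by rewrite (bigD1 v) //= eqxx big1 ?addr0 // => w /negPf ->.
- rewrite (_ : finset _ = [set v]%SET); first exact: face_vertex.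
  by apply/setP => w; rewrite !inE pnatr_eq0 eqb0 negbK.
Qed.

Definition vertex_point (v : V) : realization := SigSub (vertex_subproof v).

End realization.

Record connected_graph := ConnectedGraph {
  vertex :> finType;
  adj : rel vertex;
  adj_sym : symmetric adj;
  adj_irr : irreflexive adj;
  adj_connected : forall u v, connect adj u v }.

Section graph_realization.
Variables (R : realType) (G : connected_graph).

Definition graph_face : set {set G} :=
  [set s | (exists u, s = [set u]%SET) \/
           (exists u v, adj u v /\ s = [set u; v]%SET)].

Lemma graph_face_neq0 s : graph_face s -> s != finset.set0.
Proof.
by move=> [[u ->]|[u [v [_ ->]]]]; apply/set0Pn; exists u; rewrite !inE eqxx.
Qed.

Lemma graph_face_sub (s t : {set G}) :
  graph_face s -> t != finset.set0 -> t \subset s -> graph_face t.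
Proof.
move=> gs t0 ts; suff [u [v [uv sE]]] : exists u v,
    (u = v \/ adj u v) /\ t \subset [set u; v]%SET.
  have ut (w : G) : (w \in t) -> w = u \/ w = v.
    by move/(fintype.subsetP sE); rewrite !inE => /orP[] /eqP; [left|right].
  have [|uNt] := boolP (u \in t); have [|vNt] := boolP (v \in t).
  - move=> vt ut'; have tE : t = [set u; v]%SET.
      by apply/eqP; rewrite finset.eqEsubset sE; apply/fintype.subsetP => w;
        rewrite !inE => /orP[] /eqP ->.
    case: uv => [uv|uv]; last by right; exists u, v.
    by left; exists u; rewrite tE -uv finset.setUid.
  - move=> ut'; left; exists u; apply/setP => w; rewrite !inE.
    apply/idP/eqP => [wt|-> //]; case: (ut _ wt) => // wv.
    by rewrite -wv wt in vNt.
  - move=> vt; left; exists v; apply/setP => w; rewrite !inE.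
    apply/idP/eqP => [wt|-> //]; case: (ut _ wt) => // wu.
    by rewrite -wu wt in uNt.
  - case/set0Pn: t0 => w wt; case: (ut _ wt) => wE.
      by rewrite -wE wt in uNt.
    by rewrite -wE wt in vNt.
case: gs ts => [[u ->]|[u [v [uv ->]]]] ts; last by exists u, v; split; auto.
by exists u, u; split; [left|rewrite finset.setUid].
Qed.

Lemma graph_face_vertex u : graph_face [set u]%SET.
Proof. by left; exists u. Qed.

Definition graph_complex : simplicial_complex G :=
  SimplicialComplex graph_face_neq0 graph_face_sub graph_face_vertex.

Definition graph_space : topologicalType := realization R graph_complex.

Definition graph_point (v : G) : graph_space := vertex_point R graph_complex v.

Definition on_edge (u v : G) (x : graph_space) : Prop :=
  adj u v /\ [set w | val x w != 0]%SET \subset [set u; v]%SET.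

(* [edge_path x y l]: there is a piecewise linear path of length l from x to y,
   each piece lying in a closed edge uv. The barycentric coordinate of u is the
   isometry from that edge onto [0, 1]. *)
Inductive edge_path : graph_space -> graph_space -> R -> Prop :=
| edge_path0 x : edge_path x x 0
| edge_pathS u v x y z l : on_edge u v x -> on_edge u v y -> edge_path y z l ->
    edge_path x z (`|val x u - val y u| + l).

Definition graph_dist (x y : graph_space) : R := inf [set l | edge_path x y l].

Definition graph_ball (x : graph_space) (r : R) : set graph_space :=
  [set y | graph_dist x y <= r].

Lemma graph_dist_xx x : graph_dist x x <= 0.
Proof.
apply: ge_inf; last exact: edge_path0.
by exists 0 => l /=; elim => {x l} [x|u v x y z l _ _ _ l0]; rewrite ?addr_ge0.
Qed.

End graph_realization.

Section cech.
Variables (R : realType) (G : connected_graph) (r : R) (r0 : 0 <= r).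

Definition cech_face : set {set G} :=
  [set s | s != finset.set0 /\
    exists x : graph_space R G,
      forall v, v \in s -> graph_ball (graph_point R v) (r / 2) x].

Lemma cech_face_neq0 s : cech_face s -> s != finset.set0.
Proof. by case. Qed.

Lemma cech_face_sub (s t : {set G}) :
  cech_face s -> t != finset.set0 -> t \subset s -> cech_face t.
Proof.
move=> [_ [x sx]] t0 /fintype.subsetP ts; split=> //.
by exists x => v /ts; exact: sx.
Qed.

Lemma cech_face_vertex v : cech_face [set v]%SET.
Proof.
split; first by apply/set0Pn; exists v; rewrite inE.
exists (graph_point R v) => w; rewrite inE => /eqP ->.
by apply: le_trans (graph_dist_xx _) _; rewrite divr_ge0.
Qed.

Definition cech : simplicial_complex G :=
  SimplicialComplex cech_face_neq0 cech_face_sub cech_face_vertex.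

End cech.
Arguments cech {R} G r r0.

Section hypercube.
Variable n : nat.
Implicit Types x y : n.-tuple bool.

Definition hamming_diff x y : {set 'I_n} :=
  [set i | tnth x i != tnth y i]%SET.

Definition cube_adj x y : bool := #|hamming_diff x y| == 1%N.

Lemma hamming_diffC x y : hamming_diff x y = hamming_diff y x.
Proof. by apply/setP => i; rewrite !inE eq_sym. Qed.

Lemma cube_adj_sym : symmetric cube_adj.
Proof. by move=> x y; rewrite /cube_adj hamming_diffC. Qed.

Lemma cube_adj_irr : irreflexive cube_adj.
Proof.
move=> x; rewrite /cube_adj (_ : hamming_diff _ _ = finset.set0) ?cards0 //.
by apply/setP => i; rewrite !inE eqxx.
Qed.

Lemma cube_connected x y : connect cube_adj x y.
Proof.
move: {2}#|_| (erefl #|hamming_diff x y|) => k.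
elim: k x => [|k IH] x.
  move=> /eqP; rewrite cards_eq0 => /eqP xy.
  rewrite (_ : x = y) //; apply: eq_from_tnth => i.
  by move/setP: xy => /(_ i); rewrite !inE => /negbFE/eqP.
move=> xyk; have /set0Pn[i ixy] : hamming_diff x y != finset.set0.
  by rewrite -card_gt0 xyk.
pose z := [tuple if j == i then ~~ tnth x j else tnth x j | j < n].
have zx : hamming_diff x z = [set i]%SET.
  apply/setP => j; rewrite !inE tnth_mktuple.
  by case: (j == i); [case: (tnth x j) | rewrite eqxx].
have zy : hamming_diff z y = (hamming_diff x y :\ i)%SET.
  apply/setP => j; rewrite !inE tnth_mktuple.
  case: (j =P i) => [->|//]; move: ixy; rewrite inE.
  by case: (tnth x i); case: (tnth y i).
apply: (connect_trans (y := z)).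
  by apply: connect1; rewrite /cube_adj zx cards1.
apply: IH; apply/eqP; rewrite zy -eqSS -xyk.
by rewrite (cardsD1 i (hamming_diff x y)) ixy.
Qed.

Definition hypercube : connected_graph :=
  ConnectedGraph cube_adj_sym cube_adj_irr cube_connected.

End hypercube.

(* Main.v *)
Require Import Defs.
From mathcomp Require Import all_boot all_order all_algebra.
From mathcomp Require Import all_classical reals.
From mathcomp Require Import topology normedtype homotopy.
From mathcomp Require Import zify ring lra.

(* Faces are the sets of vertices lying in the closed neighborhood N[v] of some
   vertex v, and two of the simplices N[v] meet at most in an edge.  Let c(v) be
   v with its highest bit m(v) erased (c(0) = 0), and order the vertices as
   binary numbers.  Pushing towards c(v) retracts each N[v] onto the cone with
   apex c(v) over the edges of its opposite face; this leaves a 2-dimensional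
   complex.  From it remove the triangles with apex c(v) over the edges
   {v + e_a, v + e_b} with a < b < m(v) and b a bit of v, i.e. over the edges
   that already lie in N[w] for a smaller w.  What remains collapses to a point,
   for decreasing v.  By homotopy extension the complex is then homotopy
   equivalent to its quotient by this contractible part, which is a wedge of
   2-spheres, one for each removed triangle. *)

Set Implicit Arguments.
Unset Strict Implicit.
Unset Printing Implicit Defensive.

Import Order.TTheory GRing.Theory Num.Theory.
Import numFieldNormedType.Exports.

Local Open Scope classical_set_scope.
Local Open Scope ring_scope.

(** * Continuity *)

(** The ball around v consists of the v + e_a with e_0 = 0, and e_0, ..., e_n form a Sidon set in
    F_2^n. Hence an edge {v + e_a, v + e_b} lies in exactly two balls, with centers v and v + e_a +
    e_b. For a < b these differ in bit b and the smaller one lacks it; this is why a bit of v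
    decides which triangles are removed. In terms of discrete Morse theory, write each edge with its
    smaller center v. If v + e_a is not c(v), the edge is matched with the triangle c(v), v + e_a, v
    + e_b. Otherwise it is {c(v), v + e_b} with b > m(v), and is matched with the vertex v + e_b.
    Only the vertex 0 and the triangles whose base is written with its larger center stay unmatched.
    For fixed b there are b choices of a and 2^(n-1) - 2^(b-1) choices of v, and summing over b
    gives the number of spheres. The topological obstacle is that maps and homotopies have to
    descend to the wedge; compactness of the realization turns the projection onto the wedge into a
    closed map, so that they do. *)

Section continuity.
Variables (R : realType) (X : topologicalType).
Implicit Types f g : X -> R.

Lemma continuous_ptws (I : Type) (f : X -> {ptws I -> R}) :
  (forall i, continuous (fun x => f x i)) -> continuous f.
Proof.
move=> cf x; apply/cvg_sup => i; move: x.
exact: (@continuous_comp_initial _ _ _ (@^~ i) f (cf i)).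
Qed.

Lemma cts_cst (a : R) : continuous (fun _ : X => a).
Proof. by move=> x; exact: cvg_cst. Qed.

Lemma cts_add f g : continuous f -> continuous g ->
  continuous (fun x => f x + g x).
Proof. by move=> cf cg x; apply: continuousD; [exact: cf|exact: cg]. Qed.

Lemma cts_opp f : continuous f -> continuous (fun x => - f x).
Proof. by move=> cf x; apply: continuousN; exact: cf. Qed.

Lemma cts_mul f g : continuous f -> continuous g ->
  continuous (fun x => f x * g x).
Proof. by move=> cf cg x; apply: continuousM; [exact: cf|exact: cg]. Qed.

Lemma cts_exp f (k : nat) : continuous f -> continuous (fun x => f x ^+ k).
Proof.
move=> cf; elim: k => [|k IHk]; first exact: cts_cst.
by under eq_fun do rewrite exprS; exact: cts_mul.
Qed.

Lemma cts_inv f : (forall x, f x != 0) -> continuous f ->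
  continuous (fun x => (f x)^-1).
Proof. by move=> f0 cf x; apply: continuousV; [exact: f0|exact: cf]. Qed.

Lemma cts_min f g : continuous f -> continuous g ->
  continuous (fun x => Num.min (f x) (g x)).
Proof. by move=> cf cg x; apply: continuous_min; [exact: cf|exact: cg]. Qed.

Lemma cts_max f g : continuous f -> continuous g ->
  continuous (fun x => Num.max (f x) (g x)).
Proof. by move=> cf cg x; apply: continuous_max; [exact: cf|exact: cg]. Qed.

Lemma cts_sum (I : Type) (r : seq I) (P : pred I) (F : I -> X -> R) :
  (forall i, continuous (F i)) -> continuous (fun x => \sum_(i <- r | P i) F i x).
Proof.
move=> cF; elim: r => [|i r IHr].
  by under eq_fun do rewrite big_nil; exact: cts_cst.
have [Pi|Pi] := boolP (P i); last by under eq_fun do rewrite big_cons (negbTE Pi).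
by under eq_fun do rewrite big_cons Pi; exact: cts_add.
Qed.

Lemma cts_bigmin (I : Type) (r : seq I) (P : pred I) (a : R) (F : I -> X -> R) :
  (forall i, continuous (F i)) ->
  continuous (fun x => \big[Num.min/a]_(i <- r | P i) F i x).
Proof.
move=> cF; elim: r => [|i r IHr].
  by under eq_fun do rewrite big_nil; exact: cts_cst.
have [Pi|Pi] := boolP (P i); last by under eq_fun do rewrite big_cons (negbTE Pi).
by under eq_fun do rewrite big_cons Pi; exact: cts_min.
Qed.

Lemma cts_pair (Y Z : topologicalType) (f : X -> Y) (g : X -> Z) :
  continuous f -> continuous g -> continuous (fun x => (f x, g x)).
Proof. by move=> cf cg x; apply: cvg_pair; [exact: cf|exact: cg]. Qed.

Lemma cts_comp (Y Z : topologicalType) (f : X -> Y) (g : Y -> Z) :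
  continuous f -> continuous g -> continuous (fun x => g (f x)).
Proof. by move=> cf cg x; apply: continuous_comp; [exact: cf|exact: cg]. Qed.

Lemma cts_set_type (Y : topologicalType) (A : set Y) (f : X -> set_type A) :
  continuous (fun x => set_val (f x)) -> continuous f.
Proof. exact: (@continuous_comp_initial _ _ _ set_val f). Qed.

End continuity.

Lemma cts_fst (X Y : topologicalType) : continuous (@fst X Y).
Proof. by move=> x; exact: cvg_fst. Qed.

Lemma cts_snd (X Y : topologicalType) : continuous (@snd X Y).
Proof. by move=> x; exact: cvg_snd. Qed.

Lemma cts_set_val (X : topologicalType) (A : set X) :
  continuous (set_val : set_type A -> X).
Proof. exact: initial_continuous. Qed.

Lemma cts_coord (R : realType) (I : eqType) (i : I) :
  continuous (fun x : {ptws I -> R} => x i).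
Proof. exact: (@proj_continuous I (fun=> R) i). Qed.

Lemma cts_fst_coord (R : realType) (I : eqType) (Y : topologicalType) (i : I) :
  continuous (fun z : {ptws I -> R} * Y => z.1 i).
Proof. exact: (cts_comp (@cts_fst _ Y) (@cts_coord R I i)). Qed.

(** Syntax-directed on the body of the function. The inverse of a constant is settled at once; for
    any other inverse the nonvanishing of the denominator is left as a goal. *)
Ltac cts := repeat lazymatch goal with
  | H : continuous ?f |- continuous ?f => exact: H
  | |- continuous (fun z => @?f z + @?g z) => apply: (@cts_add _ _ f g)
  | |- continuous (fun z => - @?f z) => apply: (@cts_opp _ _ f)
  | |- continuous (fun z => @?f z * @?g z) => apply: (@cts_mul _ _ f g)
  | |- continuous (fun z => @?f z ^+ ?k) => apply: (@cts_exp _ _ f k)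
  | |- continuous (fun z => Num.min (@?f z) (@?g z)) => apply: (@cts_min _ _ f g)
  | |- continuous (fun z => Num.max (@?f z) (@?g z)) => apply: (@cts_max _ _ f g)
  | |- continuous (fun z => \sum_(i <- ?s | @?P i) @?f i z) =>
      apply: (@cts_sum _ _ _ s P f) => ?
  | |- continuous (fun z => \big[Num.min/_]_(i <- ?s | @?P i) @?f i z) =>
      apply: (@cts_bigmin _ _ _ s P _ f) => ?
  | |- continuous (fun z => (@?f z, @?g z)) => apply: (@cts_pair _ _ _ f g)
  | |- continuous (fun z => (@?h z)^-1) =>
      first [exact: cts_cst | apply: (@cts_inv _ _ h)]
  | |- continuous _ => first [ exact: cts_fst_coord | exact: cts_coord
      | exact: cts_fst | exact: cts_snd | exact: cts_set_val | exact: cts_cst ]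
  end.

(** * Retractions of realizations *)

Section retraction.
Variables (R : realType) (V : finType).
Local Notation E := {ptws V -> R}.
Implicit Types (A B C : set E) (F G : set {set V}) (s t : {set V}).

Definition supp (x : E) : {set V} := [set v | x v != 0]%SET.

(** For [F = face K] this is [realization_set]. All complexes on [V] thus become subsets of the one
    space R^V. *)
Definition geom F : set E :=
  [set x | [/\ forall v, 0 <= x v, \sum_v x v = 1 & F (supp x)]].

(* Homotopies are continuous on the whole of R^V, so that they compose without
   any pasting; only their effect on [A] matters. *)
Definition retracts A B := exists H : E * R -> E,
  [/\ continuous H, forall x, H (x, 0) = x,
      forall x (t : R), A x -> 0 <= t <= 1 -> A (H (x, t)),
      forall x, A x -> B (H (x, 1))
    & forall x (t : R), B x -> H (x, t) = x].

Lemma retracts_refl A : retracts A A.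
Proof. by exists fst; split => //; exact: cts_fst. Qed.

(** Truncated times replace a case distinction: [H] rests at time 1 during the second half and [K]
    at time 0, where it is the identity, during the first. The concatenation is therefore a plain
    composite of continuous maps. *)
Lemma retracts_trans A B C : C `<=` B -> B `<=` A ->
  retracts A B -> retracts B C -> retracts A C.
Proof.
move=> CB BA [H [cH H0 HA HB Hfix]] [K [cK K0 KB KC Kfix]].
exists (fun z => K (H (z.1, Num.min 1 (2 * z.2)), Num.max 0 (2 * z.2 - 1))).
split => [|x|x t Ax /andP[t0 t1]|x Ax|x t Cx] /=.
- apply: (cts_comp (g := K)) => //; apply: cts_pair; last by cts.
  by apply: (cts_comp (g := H)) => //; cts.
- rewrite mulr0 (min_idPr _) ?ler01 // H0 sub0r (max_idPl _) ?oppr_le0 ?ler01 //.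
- have [th|th] := lerP (2 * t) 1.
    by rewrite (max_idPl _) ?subr_le0 // K0; apply: HA => //; lra.
  apply: BA; rewrite (max_idPr _); last by lra.
  by apply: KB; [exact: HB|lra].
- rewrite mulr1 (min_idPl _) ?ler1n // (max_idPr _); last by lra.
  by rewrite (_ : 2 - 1 = 1); [apply: KC; exact: HB|lra].
- by rewrite Hfix ?Kfix //; exact: CB.
Qed.

Lemma geomS F G : F `<=` G -> geom F `<=` geom G.
Proof. by move=> FG x [x0 x1 Fx]; split => //; exact: FG. Qed.

Lemma geom_le1 F x v : geom F x -> x v <= 1.
Proof. by case=> x0 <- _; rewrite (bigD1 v) //= lerDl sumr_ge0. Qed.

Lemma supp_neq0 (x : E) : \sum_v x v = 1 -> supp x != finset.set0.
Proof.
move=> x1; apply/set0Pn; apply: contrapT => /forallNP nx; move: x1.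
rewrite big1 => [/esym/eqP|v _]; first by rewrite oner_eq0.
by move: (nx v); rewrite inE => /negP/negPn/eqP.
Qed.

Definition subset_closed F :=
  forall s t, F s -> t != finset.set0 -> t \subset s -> F t.

(** On nonnegative points it is positive exactly when [s] lies in the support, that is, over the
    open star of [s]. The initial value 1 is harmless because barycentric coordinates are at most
    1. *)
Definition minon s (x : E) : R := \big[Num.min/1]_(v in s) x v.

Lemma minon_le s x v : v \in s -> minon s x <= x v.
Proof. by move=> vs; rewrite /minon (bigD1 v) //= ge_min lexx. Qed.

Lemma minon_ge0 s x : (forall v, 0 <= x v) -> 0 <= minon s x.
Proof.
move=> x0; rewrite /minon; elim/big_ind: _ => // a b a0 b0.
by rewrite le_min a0.
Qed.

Lemma minon_gt0 s x : (forall v, v \in s -> 0 < x v) -> 0 < minon s x.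
Proof.
move=> x0; rewrite /minon; elim/big_ind: _ => // a b a0 b0.
by rewrite lt_min a0.
Qed.

Lemma minon_attained s x : s != finset.set0 -> (forall v, x v <= 1) ->
  exists2 v, v \in s & minon s x = x v.
Proof.
case/set0Pn => w ws xle1.
have [E|] : minon s x = 1 \/ exists2 v, v \in s & minon s x = x v.
  rewrite /minon; elim/big_rec: _ => [|v a vs [->|[u us ->]]]; first by left.
    by right; exists v => //; rewrite (min_idPl _).
  by right; rewrite /Num.min; case: ifP => _; [exists v|exists u].
- exists w => //; apply/eqP; rewrite E eq_le xle1 andbT -E; exact: minon_le.
- by [].
Qed.

Lemma minon_eq0 s x : (forall v, 0 <= x v) -> ~~ (s \subset supp x) ->
  minon s x = 0.
Proof.
move=> x0 /subsetPn[v vs]; rewrite inE negbK => /eqP xv.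
by apply/eqP; rewrite eq_le minon_ge0 // andbT -xv minon_le.
Qed.

Lemma minon_supp s x : (forall v, 0 <= x v) -> s \subset supp x ->
  0 < minon s x.
Proof.
move=> x0 /fintype.subsetP sx; apply: minon_gt0 => v /sx.
by rewrite inE lt_def x0 andbT.
Qed.

Definition minus_star F s : set {set V} := [set t | F t /\ ~~ (s \subset t)].

(* The points of the open star of [s] are pushed away from the barycenter of [s]
   towards [c] until one of the coordinates in [s] vanishes. *)
Lemma collapse F s c : subset_closed F -> s != finset.set0 -> c \notin s ->
  (forall t, F t -> s \subset t -> F (c |: t)%SET) ->
  retracts (geom F) (geom (minus_star F s)).
Proof.
move=> Fc s0 cs cone.
(* Each coordinate in [s] loses [t * minon s x] and [c] gains the total, so the sum stays 1. At time
   1 the least coordinate in [s] vanishes, and off the open star nothing moves. *)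
pose H (z : E * R) : E := fun v =>
  z.1 v + z.2 * minon s z.1 * (#|s|%:R * (v == c)%:R - (v \in s)%:R).
have Hmin0 x (t : R) : minon s x = 0 -> H (x, t) = x.
  by move=> m0; apply/funext => v; rewrite /H /= m0 mulr0 mul0r addr0.
have HF x (t : R) : geom F x -> 0 <= t <= 1 -> geom F (H (x, t)).
  move=> Fx /andP[t0 t1]; have [x0 x1 Fs] := Fx.
  have [m0|m0] := eqVneq (minon s x) 0; first by rewrite Hmin0.
  have mge0 := minon_ge0 s x0.
  have H1 : \sum_v H (x, t) v = 1.
    rewrite big_split /= x1 -mulr_sumr sumrB -mulr_sumr.
    have -> : \sum_i (i == c)%:R = 1 :> R.
      by rewrite (bigD1 c) //= eqxx big1 ?addr0 // => i /negPf ->.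
    have -> : \sum_i (i \in s)%:R = #|s|%:R :> R.
      rewrite -natr_sum; have -> // : (\sum_i (i \in s) = #|s|)%N.
      by rewrite -sum1_card [in RHS]big_mkcond; apply: eq_bigr => i _; case: (i \in s).
    by rewrite mulr1 subrr mulr0 addr0.
  split => // [v|].
    rewrite /H /=; have [vs|vs] := boolP (v \in s).
      have -> : (v == c) = false by apply: contraNF cs => /eqP <-.
      have := minon_le x vs; rewrite mulr0 sub0r /=; nra.
    by rewrite subr0 addr_ge0 // !mulr_ge0 ?ler0n.
  have sx : s \subset supp x.
    by apply: contraNT m0 => /(minon_eq0 x0) ->.
  apply: Fc (cone _ Fs sx) (supp_neq0 H1) _; apply/fintype.subsetP => v.
  rewrite !inE; apply: contraR; rewrite negb_or negbK => /andP[/negPf vc /eqP xv].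
  rewrite /H /= vc xv mulr0 sub0r add0r; case: (boolP (v \in s)) => [vs|].
    by move/fintype.subsetP: sx => /(_ _ vs); rewrite inE xv eqxx.
  by rewrite oppr0 mulr0.
exists H; split => //.
- by apply: continuous_ptws => v; rewrite /H /minon; cts.
- by move=> x; apply/funext => v; rewrite /H /= !mul0r addr0.
- move=> x Fx; have /HF : 0 <= (1 : R) <= 1 by rewrite ler01 lexx.
  move=> /(_ _ Fx) [H0 H1 FH]; split => //; split => //.
  have [x0 _ _] := Fx.
  have [v vs mv] := minon_attained s0 (fun v => geom_le1 v Fx).
  apply/subsetPn; exists v => //; rewrite inE negbK /H /= mv vs.
  have -> : (v == c) = false by apply: contraNF cs => /eqP <-.
  by rewrite mulr0 sub0r mul1r mulrN1 subrr.
- by move=> x t [x0 x1 [_ sx]]; apply: Hmin0; exact: minon_eq0.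
Qed.

End retraction.

(** * Collapsing a family of faces in order of decreasing key *)

Section collapse_family.
Variables (R : realType) (V I : finType).
Variables (F : set {set V}) (P : {set I}) (sg : I -> {set V}) (ap : I -> V).
Variable key : I -> nat.

Definition avoid (D : {set I}) : set {set V} :=
  [set t | F t /\ forall i, i \in D -> ~~ (sg i \subset t)].

Hypothesis Fclosed : subset_closed F.
Hypothesis sg_neq0 : forall i, i \in P -> sg i != finset.set0.
Hypothesis ap_sg : forall i, i \in P -> ap i \notin sg i.
Hypothesis cone : forall i t, i \in P -> F t -> sg i \subset t ->
  (forall j, j \in P -> (key i < key j)%N -> ~~ (sg j \subset t)) ->
  F (ap i |: t)%SET /\
  (forall j, j \in P -> (key i <= key j)%N -> j != i ->
     sg j \subset (ap i |: t)%SET -> sg j \subset t).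

Lemma avoid_closed D : subset_closed (avoid D).
Proof.
move=> s t [Fs sD] t0 ts; split; first exact: Fclosed Fs t0 ts.
by move=> i iD; apply: contra (sD i iD) => /fintype.subset_trans; exact.
Qed.

(** The set [D] of treated indices grows by an index [i] of greatest remaining key. Then all
    strictly greater keys are in [D], which is the premise of [cone], and all keys in [D] are at
    least that of [i], so the second clause of [cone] says that adding the apex brings back no
    removed face. Equal keys may come in any order. *)
Lemma collapse_family : retracts (@geom R V F) (geom (avoid P)).
Proof.
suff H k D : #|P :\: D| = k -> D \subset P ->
    (forall i j, i \in D -> j \in P -> (key i < key j)%N -> j \in D) ->
    retracts (@geom R V (avoid D)) (geom (avoid P)).
  have -> : F = avoid finset.set0.
    apply/seteqP; split => t; last by case.
    by move=> Ft; split => // i; rewrite inE.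
  by apply: H => //; rewrite ?finset.sub0set // => i j; rewrite inE.
elim: k D => [|k IHk] D.
  move=> /eqP; rewrite cards_eq0 finset.setD_eq0 => PD DP _.
  have -> : D = P by apply/eqP; rewrite finset.eqEsubset DP PD.
  exact: retracts_refl.
move=> Dk DP up.
have /set0Pn[i0 i0PD] : P :\: D != finset.set0 by rewrite -card_gt0 Dk.
have [i iPD imax] := @arg_maxnP I i0 (fun i => i \in P :\: D) key i0PD.
have [iP iD] : i \in P /\ i \notin D by move: iPD; rewrite inE => /andP[].
have keyD j : j \in D -> (key i <= key j)%N.
  by move=> jD; rewrite leqNgt; apply: contra iD; exact: up.
have keyPD j : j \in P -> (key i < key j)%N -> j \in D.
  move=> jP; rewrite ltnNge; apply: contraR => jD.
  by apply: imax; rewrite inE jD.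
have avoidi : minus_star (avoid D) (sg i) = avoid (i |: D)%SET.
  apply/seteqP; split => t [].
    by move=> [Ft tD] it; split => // j; rewrite !inE => /orP[/eqP ->|/tD].
  move=> Ft tD; split; last by apply: tD; rewrite !inE eqxx.
  by split => // j jD; apply: tD; rewrite !inE jD orbT.
apply: (@retracts_trans _ _ _ (geom (avoid (i |: D)%SET))).
- apply: geomS => t [Ft tP]; split => // j; rewrite !inE => /orP[/eqP ->|jD].
    exact: tP.
  by apply: tP; apply: (fintype.subsetP DP).
- apply: geomS => t [Ft tD]; split => // j jD.
  by apply: tD; rewrite !inE jD orbT.
- rewrite -avoidi; apply: (@collapse _ _ _ _ (ap i)) => //.
  + exact: avoid_closed.
  + exact: sg_neq0.
  + exact: ap_sg.
  + move=> t [Ft tD] it; have tP j : j \in P -> (key i < key j)%N ->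
        ~~ (sg j \subset t) by move=> jP ij; apply: tD; exact: keyPD.
    have [Fit sub] := cone iP Ft it tP.
    split => // j jD; apply: contra (tD j jD) => jt; apply: sub => //.
    * exact: (fintype.subsetP DP).
    * exact: keyD.
    * by apply: contraNneq iD => <-.
- apply: IHk.
  + move: Dk; rewrite (cardsD1 i) iPD add1n => -[<-]; apply: eq_card => j.
    by rewrite !inE negb_or andbA.
  + by rewrite finset.subUset finset.sub1set iP.
  + move=> j l; rewrite !inE => /orP[/eqP ->|jD] lP jl.
      by rewrite keyPD ?orbT.
    by rewrite (up j l) ?orbT.
Qed.

End collapse_family.

(** * Compactness and quotients *)

Lemma cluster_image (X Y : topologicalType) (f : X -> Y) (x y : X) :
  continuous f -> cluster (nbhs x) y -> cluster (nbhs (f x)) (f y).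
Proof.
move=> cf cl A B /cf nA /cf nB.
by have [z [Az Bz]] := cl _ _ nA nB; exists (f z).
Qed.

Lemma hausdorff_set_type (X : topologicalType) (A : set X) :
  hausdorff_space X -> hausdorff_space (set_type A).
Proof.
move=> hX x y /(cluster_image (@cts_set_val X A))/hX; exact: val_inj.
Qed.

Lemma hausdorff_prod (X Y : topologicalType) :
  hausdorff_space X -> hausdorff_space Y -> hausdorff_space (X * Y)%type.
Proof.
move=> hX hY [x1 x2] [y1 y2] cl; congr pair.
- exact/hX/(cluster_image (@cts_fst X Y) cl).
- exact/hY/(cluster_image (@cts_snd X Y) cl).
Qed.

Lemma compact_set_type (X : topologicalType) (A : set X) :
  compact A -> compact [set: set_type A].
Proof.
move=> cA F FF _.
have [|x [Ax clx]] := cA (set_val @ F) _.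
  by rewrite /= nbhs_simpl; apply: (@filterS _ F _ setT) filterT => y _ /=; exact: set_valP.
exists (SigSub (mem_set Ax)); split => // B C FB.
move=> [_ [[U oU <-] /= Ux UC]].
have [||_ [[y By <-] Uy]] := clx (set_val @` B) U.
- by rewrite /= nbhs_simpl; apply: (@filterS _ F _ B) FB => y By; exists y.
- by apply: open_nbhs_nbhs; split.
- by exists y; split => //; exact: UC.
Qed.

Lemma compactT_prod (X Y : topologicalType) :
  compact [set: X] -> compact [set: Y] -> compact [set: X * Y].
Proof. by move=> cX cY; rewrite -setXTT; exact: compact_setX. Qed.

(** A continuous surjection from a compact space onto a Hausdorff space is closed, hence a quotient
    map. Maps out of the wedge are shown to be continuous in this way. *)
Lemma quotient_continuous (X Y Z : topologicalType) (q : X -> Y) (f : Y -> Z) :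
  compact [set: X] -> hausdorff_space Y -> continuous q ->
  (forall y, exists x, q x = y) -> continuous (f \o q) -> continuous f.
Proof.
move=> cX hY cq qs cfq; apply/continuous_closedP => C cC.
have -> : f @^-1` C = q @` ((f \o q) @^-1` C).
  apply/seteqP; split => [y Cy|_ [x Cx <-]] //.
  by have [x xy] := qs y; exists x => //=; rewrite xy.
apply: compact_closed => //; apply: continuous_compact.
  exact: continuous_subspaceT.
apply: (@subclosed_compact _ _ setT) => //.
by move/continuous_closedP: cfq; exact.
Qed.

Lemma continuous_mx (R : realType) (X : topologicalType) m n
    (f : X -> 'M[R]_(m, n)) :
  (forall i j, continuous (fun x => f x i j)) -> continuous f.
Proof.
move=> cf x A [P nP PA]; rewrite /= nbhs_simpl.
apply: (@filterS _ (nbhs x) _ [set y | forall i j, P i j (f y i j)]).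
  by move=> y Py; exact: PA.
by apply: filter_forall => i; apply: filter_forall => j; apply: cf; exact: nP.
Qed.

Lemma closed_preimage_ge (R : realType) (X : topologicalType) (f : X -> R) (a : R) :
  continuous f -> closed [set x | a <= f x].
Proof.
move=> cf; rewrite (_ : mkset _ = f @^-1` [set y | a <= y]) //.
by apply: closed_comp => [x _|]; [exact: cf|exact: closed_ge].
Qed.

Lemma closed_preimage_le (R : realType) (X : topologicalType) (f : X -> R) (a : R) :
  continuous f -> closed [set x | f x <= a].
Proof.
move=> cf; rewrite (_ : mkset _ = f @^-1` [set y | y <= a]) //.
by apply: closed_comp => [x _|]; [exact: cf|exact: closed_le].
Qed.

Section geom_compact.
Variables (R : realType) (V : finType).

(** The condition on the support is closed: for a complex it says that [minon s x <= 0] for every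
    nonempty set [s] that is not a face. The rest is Tychonoff for the cube. *)
Lemma geom_compact (F : set {set V}) : subset_closed F -> compact (@geom R V F).
Proof.
move=> Fc; pose cube := [set x : {ptws V -> R} | forall v, `[0, 1]%classic (x v)].
apply: (@subclosed_compact _ _ cube).
- have -> : @geom R V F = (\bigcap_v [set x | 0 <= x v]) `&`
      ([set x | 1 <= \sum_v x v] `&` [set x | \sum_v x v <= 1]) `&`
      \bigcap_(s in [set s | s != finset.set0 /\ ~ F s]) [set x | minon s x <= 0].
    apply/seteqP; split => x.
      move=> [x0 x1 Fx]; split; first by split => [v _|]; rewrite /= ?x1.
      move=> s [s0 Fs] /=; rewrite minon_eq0 //; apply/negP => sx.
      by apply: Fs; exact: Fc Fx s0 sx.
    move=> [[x0 [/= xge1 xle1]] xF].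
    have x0' v : 0 <= x v by exact: x0.
    have x1 : \sum_v x v = 1 by apply/eqP; rewrite eq_le xge1 xle1.
    split => //; apply: contrapT => Fx.
    have := xF (supp x) (conj (supp_neq0 x1) Fx); rewrite /= leNgt.
    by rewrite minon_supp.
  apply: closedI; [apply: closedI; [|apply: closedI]|].
  + by apply: closed_bigI => v _; apply: closed_preimage_ge; exact: cts_coord.
  + by apply: closed_preimage_ge; apply: cts_sum => v; exact: cts_coord.
  + by apply: closed_preimage_le; apply: cts_sum => v; exact: cts_coord.
  + apply: closed_bigI => s _; apply: closed_preimage_le.
    by apply: cts_bigmin => v; exact: cts_coord.
- by apply: (@tychonoff V (fun=> R) (fun=> [set` `[0, 1]])) => v; exact: segment_compact.
- move=> x Fx v; have [x0 _ _] := Fx.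
  by rewrite /= in_itv /= x0 (geom_le1 v Fx).
Qed.

End geom_compact.

(** * Attaching triangles to a contractible complex *)

Lemma card_set3 (T : finType) (x y z : T) : x != y -> x != z -> y != z ->
  #|[set x; y; z]%SET| = 3.
Proof.
move=> xy xz yz; rewrite finset.setUC cardsU1 cards2 !inE xy.
by rewrite (eq_sym z x) (negbTE xz) (eq_sym z y) (negbTE yz).
Qed.

Section attach_triangles.
Variables (R : realType) (V : finType) (N : nat).
Variables (L L' : set {set V}) (p q r : 'I_N -> V).
Local Notation E := {ptws V -> R}.

Definition tri i : {set V} := [set p i; q i; r i]%SET.

Hypothesis L'_closed : subset_closed L'.
Hypothesis L'P : forall t, L' t <-> L t \/ exists i, t = tri i.
Hypothesis triNL : forall i, ~ L (tri i).
Hypothesis pqr_uniq : forall i, uniq [:: p i; q i; r i].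
Hypothesis L'_card : forall t, L' t -> (#|t| <= 3)%N.
Hypothesis tri_inj : injective tri.

Lemma in_tri i v : (v \in tri i) = [|| v == p i, v == q i | v == r i].
Proof. by rewrite !inE orbA. Qed.

Lemma pqr_neq i : [/\ (p i == q i) = false, (p i == r i) = false
  & (q i == r i) = false].
Proof.
have := pqr_uniq i; rewrite /= !inE negb_or => /andP[/andP[]].
by move=> /negPf -> /negPf -> /andP[/negPf -> _].
Qed.

Lemma card_tri i : #|tri i| = 3.
Proof.
by have [pq pr qr] := pqr_neq i; rewrite card_set3 ?pq ?pr ?qr.
Qed.

Lemma sum_tri i (x : E) : (forall v, v \notin tri i -> x v = 0) ->
  \sum_v x v = x (p i) + x (q i) + x (r i).
Proof.
move=> x0; have [pq pr qr] := pqr_neq i.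
rewrite (bigD1 (p i)) //= (bigD1 (q i)) /=; last by rewrite eq_sym pq.
rewrite (bigD1 (r i)) /=; last by rewrite eq_sym pr eq_sym qr.
rewrite big1 ?addr0 ?addrA // => v /andP[/andP[vp vq] vr].
by apply: x0; rewrite in_tri !negb_or vp vq vr.
Qed.

Definition mu i (x : E) : R := Num.min (x (p i)) (Num.min (x (q i)) (x (r i))).

Lemma cts_mu i : continuous (mu i).
Proof. by rewrite /mu; do ![apply: cts_min]; exact: cts_coord. Qed.

Lemma mu_le i x v : v \in tri i -> mu i x <= x v.
Proof.
rewrite in_tri /mu => /or3P[] /eqP ->.
- by rewrite ge_min lexx.
- by rewrite !ge_min lexx orbT.
- by rewrite !ge_min lexx !orbT.
Qed.

Lemma mu_attained i x : exists2 v, v \in tri i & mu i x = x v.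
Proof.
rewrite /mu; have [_|_] := lerP (x (p i)) (Num.min _ _).
  by exists (p i) => //; rewrite in_tri eqxx.
have [_|_] := lerP (x (q i)) (x (r i)).
  by exists (q i) => //; rewrite in_tri eqxx !orbT.
by exists (r i) => //; rewrite in_tri eqxx !orbT.
Qed.

Lemma mu_ge0 i (x : E) : (forall v, 0 <= x v) -> 0 <= mu i x.
Proof. by move=> x0; have [v _ ->] := mu_attained i x. Qed.

(** Faces have at most three vertices, so a face that contains a triangle equals it. Thus [mu i] is
    positive exactly on the open triangle [i], and these open triangles are disjoint. *)
Lemma mu_gt0 i x : geom L' x -> (0 < mu i x) = (supp x == tri i).
Proof.
move=> [x0 x1 Lx]; apply/idP/eqP => [m0|sx].
  apply/esym/eqP; rewrite eqEcard card_tri L'_card // andbT.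
  apply/fintype.subsetP => v vi; rewrite inE gt_eqF //.
  exact: lt_le_trans m0 (mu_le x vi).
have [v vi ->] := mu_attained i x; move: vi; rewrite -sx inE => xv.
by rewrite lt_def xv x0.
Qed.

Lemma mu_out i x v : geom L' x -> 0 < mu i x -> v \notin tri i -> x v = 0.
Proof. by move=> Lx; rewrite mu_gt0 // => /eqP <-; rewrite inE negbK => /eqP. Qed.

Lemma mu_sum i x : geom L' x -> 0 < mu i x ->
  x (p i) + x (q i) + x (r i) = 1.
Proof.
move=> Lx m0; rewrite -(@sum_tri i); first by case: Lx.
by move=> v; exact: mu_out.
Qed.

Lemma mu_uniq i j x : geom L' x -> 0 < mu i x -> j != i -> mu j x = 0.
Proof.
move=> Lx m0 ji; apply/eqP; rewrite eq_le mu_ge0 ?andbT; last by case: Lx.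
rewrite leNgt; apply: contra ji; move: m0; rewrite !mu_gt0 // => /eqP -> /eqP.
by move/tri_inj ->.
Qed.

Lemma geomL_mu x : geom L' x -> geom L x <-> forall i, mu i x = 0.
Proof.
move=> Lx; have [x0 x1 L'x] := Lx; split => [[_ _ Lsx] i|m0].
  apply/eqP; rewrite eq_le mu_ge0 ?andbT // leNgt mu_gt0 //.
  by apply/eqP => sx; apply: (triNL (i := i)); rewrite -sx.
split => //; have [//|[i sx]] := (L'P _).1 L'x.
by have := mu_gt0 i Lx; rewrite sx eqxx m0 ltxx.
Qed.

Lemma geomL_sub : geom L `<=` @geom R V L'.
Proof. by apply: geomS => t Lt; apply/L'P; left. Qed.

(** * Homotopy extension from [L] to [L'] *)

Section homotopy_extension.
Variables (h : E * R -> E).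
Hypothesis cts_h : continuous h.
Hypothesis h0 : forall x, h (x, 0) = x.
Hypothesis hL : forall x (t : R), geom L x -> 0 <= t <= 1 -> geom L (h (x, t)).

(** A gauge of the triangle: 0 at the barycenter, 1 on the boundary. In [scale] the bound [2^-1]
    avoids a division by 0 and does not affect the minimum for t <= 1, since then 1 + t <= 2. The
    time [delay] is the excess over 1 of the radius multiplied by 1 + t; on [L] it is t. *)
Let radius i x : R := 1 - 3 * mu i x.
Let scale i (z : E * R) : R :=
  Num.min (Num.max (radius i z.1) (2^-1))^-1 (1 + z.2).
Let dilate (z : E * R) : E := fun v =>
  z.1 v + \sum_i (scale i z - 1) * (z.1 v - (v \in tri i)%:R / 3).
Let delay (z : E * R) : R :=
  Num.max 0 ((1 - 3 * \sum_i mu i z.1) * (1 + z.2) - 1).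

(* Each triangle is dilated from its barycenter by a factor at most [1 + t];
   what would leave the triangle is stopped at its boundary and moved by [h]
   from then on. *)
Definition hep (z : E * R) : E := h (dilate z, delay z).

Lemma cts_hep : continuous hep.
Proof.
apply: (cts_comp (g := h)) => //; apply: cts_pair; last first.
  by rewrite /delay /mu; cts.
apply: continuous_ptws => v; rewrite /dilate /scale /radius /mu; cts.
by move=> z; rewrite gt_eqF // lt_max invr_gt0 ltr0n orbT.
Qed.

(** Only nonnegativity is assumed, because this is also applied to points of [geom (face K)] that
    have not yet been pushed into [geom L']. *)
Lemma hep0 (x : E) : (forall v, 0 <= x v) -> hep (x, 0) = x.
Proof.
move=> x0; have m0 i := mu_ge0 i x0.
have -> : hep (x, 0) = h (x, 0); last exact: h0.
rewrite /hep; congr (h (_, _)).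
  apply/funext => v; rewrite /dilate big1 ?addr0 // => i _ /=.
  rewrite /scale /= addr0 (min_idPr _) ?subrr ?mul0r //.
  rewrite invf_ge1 ?ge_max ?lt_max ?invr_gt0 ?ltr0n ?orbT //.
  by rewrite /radius; have := m0 i; lra.
rewrite /delay /= addr0 mulr1 (max_idPl _) //.
by have : 0 <= \sum_i mu i x; [exact: sumr_ge0|lra].
Qed.

Lemma hep_L x (t : R) : geom L x -> 0 <= t -> hep (x, t) = h (x, t).
Proof.
move=> Lx t0; have m0 := (geomL_mu (geomL_sub Lx)).1 Lx.
rewrite /hep; congr (h (_, _)).
  apply/funext => v; rewrite /dilate big1 ?addr0 // => i _ /=.
  rewrite /scale /radius /= m0 mulr0 subr0 (max_idPl _); last by lra.
  by rewrite invr1 (min_idPl _) ?subrr ?mul0r // lerDl.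
by rewrite /delay /= big1 // mulr0 subr0 mul1r addrAC subrr add0r (max_idPr _).
Qed.

Lemma hep_L_stable x (t : R) : geom L x -> 0 <= t <= 1 -> geom L (hep (x, t)).
Proof. by move=> Lx /[dup] /andP[t0 _] t01; rewrite hep_L //; exact: hL. Qed.

Lemma hep_L' x (t : R) : geom L' x -> 0 <= t <= 1 -> geom L' (hep (x, t)).
Proof.
move=> L'x /andP[t0 t1]; have [Lx|] := pselect (geom L x).
  by apply: geomL_sub; apply: hep_L_stable => //; rewrite t0.
have [x0 x1 L'sx] := L'x.
move=> /(contra_not (geomL_mu L'x).2)/existsNP[i /eqP mi].
have {mi} mi : 0 < mu i x by rewrite lt_def mi mu_ge0.
have mj j : j != i -> mu j x = 0 by exact: mu_uniq.
have delayE : delay (x, t) = Num.max 0 (radius i x * (1 + t) - 1).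
  by rewrite /delay /= (bigD1 i) //= big1 ?addr0 // => j ji; rewrite mj.
have dilateE v : dilate (x, t) v =
    x v + (scale i (x, t) - 1) * (x v - (v \in tri i)%:R / 3).
  rewrite /dilate /= (bigD1 i) //= big1 ?addr0 // => j ji.
  rewrite /scale /radius /= mj // mulr0 subr0 (max_idPl _); last by lra.
  by rewrite invr1 (min_idPl _) ?subrr ?mul0r // lerDl.
have sum1 := mu_sum L'x mi.
have mp : mu i x <= x (p i) by apply: mu_le; rewrite in_tri eqxx.
have mq : mu i x <= x (q i) by apply: mu_le; rewrite in_tri eqxx !orbT.
have mr : mu i x <= x (r i) by apply: mu_le; rewrite in_tri eqxx !orbT.
have rad0 : 0 <= radius i x <= 1 by rewrite /radius; lra.
have max0 : 0 < Num.max (radius i x) 2^-1 by rewrite lt_max invr_gt0 ltr0n orbT.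
have scale1 : 1 <= scale i (x, t).
  rewrite /scale /= le_min lerDl t0 andbT invf_ge1 // ge_max.
  by case/andP: rad0 => _ ->; lra.
have scale_rad : scale i (x, t) * radius i x <= 1.
  have H : scale i (x, t) * Num.max (radius i x) 2^-1 <= 1.
    by rewrite -ler_pdivlMr // mul1r /scale ge_min lexx.
  apply: le_trans H; apply: ler_wpM2l; first by lra.
  by rewrite le_max lexx.
have out v : v \notin tri i -> dilate (x, t) v = 0.
  by move=> vi; rewrite dilateE (mu_out L'x mi vi) (negbTE vi) mul0r subrr mulr0 addr0.
have dil0 v : 0 <= dilate (x, t) v.
  have [vi|/out -> //] := boolP (v \in tri i).
  rewrite dilateE vi mulr1n; have mv := mu_le x vi.
  have : 0 <= scale i (x, t) * (x v - mu i x) by apply: mulr_ge0; lra.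
  by move: scale_rad; rewrite /radius; set a := scale _ _; set b := mu _ _; lra.
have dil1 : \sum_v dilate (x, t) v = 1.
  rewrite (sum_tri out) !dilateE !in_tri !eqxx !orbT !mulr1n.
  have -> : x (r i) = 1 - x (p i) - x (q i) by lra.
  by field.
have dilsub : supp (dilate (x, t)) \subset tri i.
  by apply/fintype.subsetP => v; rewrite inE; apply: contraR => /out ->.
have L'i : L' (tri i) by apply/L'P; right; exists i.
have dilL' : geom L' (dilate (x, t)).
  by split => //; apply: L'_closed L'i (supp_neq0 dil1) dilsub.
(* While the radius times 1 + t is at most 1, the delay is 0 and [h] is the identity. Afterwards the
   dilated point sits on the boundary of the triangle, and [h] moves it inside [L]. *)
have [late|early] := lerP (radius i x * (1 + t) - 1) 0.
  by rewrite /hep delayE (max_idPl _) // h0.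
apply: geomL_sub; rewrite /hep; apply: hL; last first.
  by rewrite delayE le_max lexx /= ge_max ler01 /=; nra.
have radh : 2^-1 < radius i x by nra.
have scaleE : scale i (x, t) * radius i x = 1.
  rewrite /scale /= (max_idPl _) ?ltW // (min_idPl _).
    by rewrite mulVf // gt_eqF //; lra.
  rewrite -[leLHS]mul1r ler_pdivrMr; lra.
(* The least coordinate is the one that reaches 0 when the scale is the inverse of the radius. The
   support then has fewer than three vertices and is no triangle, so it lies in [L]. *)
have [v vi mv] := mu_attained i x.
have dv : dilate (x, t) v = 0.
  rewrite dilateE vi -mv mulr1n; move: scaleE; rewrite /radius.
  by set a := scale _ _; set b := mu _ _; lra.
split => //; have [_ _ /L'P[//|[j sj]]] := dilL'.
have : (#|supp (dilate (x, t))| < #|tri i|)%N.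
  apply: proper_card; apply/properP; split => //; exists v => //.
  by rewrite inE dv eqxx.
by rewrite sj !card_tri.
Qed.

End homotopy_extension.

Local Notation X' := (set_type (@geom R V L')).

(** * Open triangles as punctured spheres *)

Section sphere_coordinates.
Variable i : 'I_N.
Implicit Types x y : E.

Let w1 x : R := x (p i) - x (r i).
Let w2 x : R := x (q i) - x (r i).
Let defect x : R := 1 - (x (p i) + x (q i) + x (r i)).
Let norm2 x : R := w1 x ^+ 2 + w2 x ^+ 2 + defect x ^+ 2.
Let denom x : R := norm2 x + mu i x ^+ 2.

(* The inverse stereographic projection of [(w1, w2) / mu]. On the realization of
   [L'] either [defect] or [mu] vanishes, and [defect] keeps the denominator away
   from 0 outside of the triangle. *)
Definition sphere_coord x : 'rV[R]_3 := \row_(k < 3)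
  [:: (norm2 x - mu i x ^+ 2) / denom x; 2 * mu i x * w1 x / denom x;
      2 * mu i x * w2 x / denom x]`_k.

(** If [w1], [w2] and [defect] vanish, the three coordinates are all 1/3, and then [mu] is not 0. *)
Lemma denom_neq0 x : denom x != 0.
Proof.
have n0 : 0 <= norm2 x by rewrite !addr_ge0 ?sqr_ge0.
rewrite /denom paddr_eq0 ?sqr_ge0 // sqrf_eq0; apply/negP => /andP[].
rewrite /norm2 !paddr_eq0 ?addr_ge0 ?sqr_ge0 // !sqrf_eq0.
move=> /andP[/andP[/eqP a /eqP b] /eqP c] /eqP m0.
have [v] := mu_attained i x; rewrite in_tri m0 => /or3P[] /eqP ->.
all: by move: a b c; rewrite /w1 /w2 /defect; lra.
Qed.

Lemma cts_sphere_coord : continuous sphere_coord.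
Proof.
apply: continuous_mx => i0 k.
rewrite (_ : (fun x => _) = (fun x => [:: (norm2 x - mu i x ^+ 2) / denom x;
    2 * mu i x * w1 x / denom x; 2 * mu i x * w2 x / denom x]`_k)); last first.
  by apply/funext => x; rewrite mxE.
have cm : continuous (mu i) := @cts_mu i.
have cd : continuous (fun x => (denom x)^-1).
  by apply: cts_inv; [exact: denom_neq0|rewrite /denom /norm2 /w1 /w2 /defect /mu; cts].
case: k => -[|[|[|//]]] lt3; rewrite /norm2 /w1 /w2 /defect /=.
all: by do ?[apply: cts_mul => //]; rewrite /mu; cts.
Qed.

Lemma sphere_coord_sphere x : geom L' x -> @sphere_set R 2 (sphere_coord x).
Proof.
move=> L'x; rewrite /sphere_set /= !big_ord_recr big_ord0 /= !mxE /=.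
have d0 := denom_neq0 x.
have dm : mu i x * defect x = 0.
  have [m0|m0] := eqVneq (mu i x) 0; first by rewrite m0 mul0r.
  rewrite /defect mu_sum ?subrr ?mulr0 // lt_def m0 mu_ge0 //.
  by case: L'x.
rewrite add0r !expr_div_n -!mulrDl; apply: (@mulIf _ (denom x ^+ 2)).
  by rewrite expf_neq0.
rewrite divfK ?expf_neq0 // mul1r; apply/eqP; rewrite -subr_eq0; apply/eqP.
(* The difference to the unit sphere comes only from the term [defect], which vanishes wherever [mu]
   does not. *)
have -> : (norm2 x - mu i x ^+ 2) ^+ 2 + (2 * mu i x * w1 x) ^+ 2 +
    (2 * mu i x * w2 x) ^+ 2 - denom x ^+ 2 = - 4 * (mu i x * defect x) ^+ 2.
  by rewrite /denom /norm2; ring.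
by rewrite dm expr0n /= mulr0.
Qed.

Definition to_sphere (x : X') : sphere R 2 :=
  SigSub (mem_set (sphere_coord_sphere (set_valP x))).

Lemma cts_to_sphere : continuous to_sphere.
Proof.
apply: cts_set_type; exact: (cts_comp (@cts_set_val _ _) cts_sphere_coord).
Qed.

Lemma to_sphere_pole (x : X') : mu i (set_val x) = 0 -> to_sphere x = pole R 2.
Proof.
move=> m0; apply: val_inj; rewrite /= /sphere_coord m0; apply/rowP => k.
have := denom_neq0 (set_val x); rewrite /denom m0 expr0n /= addr0 subr0 => n0.
rewrite !mxE; case: k => -[|[|[|//]]] lt3 /=; last 2 first.
- by rewrite mulr0 !mul0r.
- by rewrite mulr0 !mul0r.
by rewrite divff.
Qed.

Lemma to_sphere_eq_pole (x : X') : to_sphere x = pole R 2 -> mu i (set_val x) = 0.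
Proof.
move=> /(congr1 val)/rowP/(_ ord0); rewrite !mxE /= => H.
have d0 := denom_neq0 (set_val x).
move/(congr1 ( *%R^~ (denom (set_val x)))): H; rewrite divfK // mul1r.
by rewrite /denom => H; apply/eqP; rewrite -sqrf_eq0; apply/eqP; lra.
Qed.

(** The point of the sphere determines [w1 / mu] and [w2 / mu]. The coordinates divided by [mu] have
    minimum 1, so their differences determine them, and the sum 1 then fixes [mu]. *)
Lemma to_sphere_inj (x y : X') : 0 < mu i (set_val x) -> 0 < mu i (set_val y) ->
  to_sphere x = to_sphere y -> x = y.
Proof.
move: x y => [x xP] [y yP] /=; rewrite !set_valE /=.
have L'x := set_mem xP; have L'y := set_mem yP => mx my.
move=> /(congr1 val)/rowP /= H; apply: val_inj => /=.
have := H (@Ordinal 3 0 isT); have := H (@Ordinal 3 1 isT).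
have := H (@Ordinal 3 2 isT); rewrite !mxE /= => {H} H2 H1 H0.
have sx := mu_sum L'x mx; have sy := mu_sum L'y my.
have dx0 := denom_neq0 x; have dy0 := denom_neq0 y.
have defx : defect x = 0 by rewrite /defect sx subrr.
have defy : defect y = 0 by rewrite /defect sy subrr.
have mx0 : mu i x != 0 by rewrite gt_eqF.
have my0 : mu i y != 0 by rewrite gt_eqF.
have cross a b : a / denom x = b / denom y -> a * denom y = b * denom x.
  by move=> ab; rewrite -[a](divfK dx0) ab mulrAC divfK.
have {}H0 := cross _ _ H0; have {}H1 := cross _ _ H1; have {}H2 := cross _ _ H2.
have Ds : denom x * mu i y ^+ 2 = denom y * mu i x ^+ 2.
  by move: H0; rewrite /denom; lra.
have par (a b : R) : 2 * mu i x * a * denom y = 2 * mu i y * b * denom x ->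
    a * mu i y = b * mu i x.
  move=> ab; have : (mu i x * denom y) * (a * mu i y - b * mu i x) = 0.
    have -> : mu i x * denom y * (a * mu i y - b * mu i x) =
      mu i y / 2 * (2 * mu i x * a * denom y) - b * (denom y * mu i x ^+ 2) by field.
    by rewrite ab -Ds; field.
  by move/eqP; rewrite !mulf_eq0 (negbTE mx0) (negbTE dy0) /= subr_eq0 => /eqP.
have {}H1 := par _ _ H1; have {}H2 := par _ _ H2.
(* Compare at the vertex where [x'] is least: there [x' / mu] is 1 and [y' / mu] is at least 1.
   Equal differences carry this over to the vertex [r i], and exchanging the points gives
   equality. *)
have half (x' y' : E) : 0 < mu i y' ->
    w1 x' * mu i y' = w1 y' * mu i x' -> w2 x' * mu i y' = w2 y' * mu i x' ->
    0 < mu i x' -> x' (r i) * mu i y' <= y' (r i) * mu i x'.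
  move=> my' e1 e2 mx'; have [v vi mv] := mu_attained i x'.
  have : mu i y' * mu i x' <= y' v * mu i x'.
    by rewrite ler_pM2r //; exact: mu_le.
  have : x' v * mu i y' = mu i y' * mu i x' by rewrite mv mulrC.
  move: e1 e2 vi; rewrite /w1 /w2 in_tri => e1 e2 /or3P[] /eqP ->; lra.
have er : x (r i) * mu i y = y (r i) * mu i x.
  by apply/eqP; rewrite eq_le !half //.
have ep : x (p i) * mu i y = y (p i) * mu i x by move: H1; rewrite /w1; lra.
have eq : x (q i) * mu i y = y (q i) * mu i x by move: H2; rewrite /w2; lra.
have mxy : mu i y = mu i x.
  have -> : mu i y = (x (p i) + x (q i) + x (r i)) * mu i y by rewrite sx mul1r.
  by rewrite !mulrDl ep eq er -!mulrDl sy mul1r.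
have can (a b : R) : a * mu i y = b * mu i x -> a = b.
  by rewrite mxy; exact: mulIf.
apply/funext => v; have [|vi] := boolP (v \in tri i); last by rewrite !(@mu_out i).
by rewrite in_tri => /or3P[] /eqP ->; exact: can.
Qed.

Lemma to_sphere_surj (s : sphere R 2) : s != pole R 2 ->
  exists x : X', 0 < mu i (set_val x) /\ to_sphere x = s.
Proof.
move=> sp; have := set_valP s; rewrite /sphere_set /= !big_ord_recr big_ord0 /= add0r.
set a := set_val s _ _; set b := set_val s _ _; set c := set_val s _ _ => s1.
have a1 : a != 1.
  apply: contraNneq sp => a1; apply/eqP/val_inj/rowP => k.
  have b0 : b = 0 by apply/eqP; rewrite -sqrf_eq0 eq_le sqr_ge0 andbT; nra.
  have c0 : c = 0 by apply/eqP; rewrite -sqrf_eq0 eq_le sqr_ge0 andbT; nra.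
  rewrite mxE; case: k => -[|[|[|//]]] lt3 /=.
  - transitivity a; last by rewrite a1.
    by rewrite /a; congr (_ _ _); apply: val_inj.
  - transitivity b; last by rewrite b0.
    by rewrite /b; congr (_ _ _); apply: val_inj.
  - transitivity c; last by rewrite c0.
    by rewrite /c; congr (_ _ _); apply: val_inj.
have a1' : 1 - a != 0 by rewrite subr_eq0 eq_sym.
have [pq pr qr] := pqr_neq i.
(* Stereographic projection of the given point from the pole (1, 0, 0). *)
have [u uE] : exists u, u = b / (1 - a) by eexists.
have [v vE] : exists v, v = c / (1 - a) by eexists.
have uv : u ^+ 2 + v ^+ 2 = (1 + a) / (1 - a).
  rewrite uE vE !expr_div_n -mulrDl; apply: (@mulIf _ ((1 - a) ^+ 2)).
    by rewrite expf_neq0.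
  rewrite divfK ?expf_neq0 // expr2 mulrA divfK //; lra.
(* The numbers 1 - m + u, 1 - m + v, 1 - m have minimum 1 and differ from the last one by u and v.
   Dividing by their sum [S] makes them barycentric coordinates with [mu] equal to 1 / S. *)
pose m := Num.min u (Num.min v 0).
have [mu_ mv m0] : [/\ m <= u, m <= v & m <= 0].
  by rewrite /m !ge_min !lexx ?orbT.
pose S := 3 - 3 * m + u + v.
have S0 : 0 < S by rewrite /S; lra.
have S0' : S != 0 by rewrite gt_eqF.
pose x : E := fun w => if w == p i then (1 - m + u) / S else
  if w == q i then (1 - m + v) / S else if w == r i then (1 - m) / S else 0.
have xp : x (p i) = (1 - m + u) / S by rewrite /x eqxx.
have xq : x (q i) = (1 - m + v) / S by rewrite /x eq_sym pq eqxx.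
have xr : x (r i) = (1 - m) / S by rewrite /x eq_sym pr eq_sym qr eqxx.
have xout w : w \notin tri i -> x w = 0.
  by rewrite in_tri !negb_or /x => /and3P[/negPf -> /negPf -> /negPf ->].
have xin w : w \in tri i -> 0 < x w.
  by rewrite in_tri => /or3P[] /eqP ->; rewrite ?xp ?xq ?xr divr_gt0 //; lra.
have mux : mu i x = S^-1.
  have -> : mu i x = Num.min (1 - m + u) (Num.min (1 - m + v) (1 - m)) / S.
    by rewrite /mu xp xq xr -!minr_pMl ?invr_ge0 ?ltW.
  rewrite -[RHS]mul1r; congr (_ / _).
  by rewrite -[RHS](subrK m) -[X in _ = _ + X]/(Num.min u (Num.min v 0)) !addr_minr addr0.
have L'x : geom L' x.
  split.
  - by move=> w; have [/xin/ltW//|/xout ->//] := boolP (w \in tri i).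
  - by rewrite (sum_tri xout) xp xq xr -!mulrDl; apply: (mulIf S0'); rewrite divfK // mul1r /S; lra.
  - apply/L'P; right; exists i; apply/setP => w; rewrite inE.
    by have [/xin/gt_eqF ->//|/xout ->] := boolP (w \in tri i); rewrite ?eqxx.
exists (SigSub (mem_set L'x)); rewrite set_valE /= mux invr_gt0; split => //.
apply: val_inj => /=.
have w1E : w1 x = u / S by rewrite /w1 xp xr -mulrBl; congr (_ / _); lra.
have w2E : w2 x = v / S by rewrite /w2 xq xr -mulrBl; congr (_ / _); lra.
have dfE : defect x = 0.
  by rewrite /defect xp xq xr -!mulrDl; apply: (mulIf S0'); rewrite mulrBl divfK // mul0r mul1r /S; lra.
have nE : norm2 x = (1 + a) / (1 - a) / S ^+ 2.
  by rewrite /norm2 w1E w2E dfE expr0n /= addr0 !expr_div_n -mulrDl uv.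
have dE : denom x = 2 / (1 - a) / S ^+ 2.
  by rewrite /denom nE mux exprVn -[X in _ + X]mul1r -mulrDl; congr (_ / _); field.
have S2 : (2 : R) != 0 by rewrite pnatr_eq0.
apply/rowP => k; rewrite mxE w1E w2E mux nE dE.
case: k => -[|[|[|//]]] lt3 /=.
- transitivity a; first by field; rewrite S0' a1'.
  by rewrite /a; congr (_ _ _); apply: val_inj.
- transitivity b; first by rewrite uE; field; rewrite S0' a1'.
  by rewrite /b; congr (_ _ _); apply: val_inj.
- transitivity c; first by rewrite vE; field; rewrite S0' a1'.
  by rewrite /c; congr (_ _ _); apply: val_inj.
Qed.

End sphere_coordinates.

Local Notation W := (wedge_spheres R N 2).

(** * The projection onto the wedge and the homotopy equivalence *)

Section quotient.
Hypothesis N_gt0 : (0 < N)%N.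

Let i0 : 'I_N := Ordinal N_gt0.

Definition to_wedge (i : 'I_N) (s : sphere R 2) : W :=
  @wedge_lift 'I_N (fun=> sphere R 2) (fun=> pole R 2) i s.

Lemma cts_to_wedge i : continuous (to_wedge i).
Proof.
exact: (@wedge_lift_continuous 'I_N (fun=> sphere R 2) (fun=> pole R 2) i).
Qed.

Lemma to_wedge_pole i j : to_wedge i (pole R 2) = to_wedge j (pole R 2).
Proof.
exact: (@wedge_liftE 'I_N (fun=> sphere R 2) (fun=> pole R 2) j (pole R 2) i
  (pole R 2)).
Qed.

(** [wedge_prod] maps the wedge to the product of the spheres, and the factor [i] of the image of
    sphere [j] is the pole unless j = i. *)
Lemma to_wedge_inj i j s t : to_wedge i s = to_wedge j t -> s != pole R 2 ->
  i = j /\ s = t.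
Proof.
move=> st sp; pose p0 (_ : 'I_N) := pole R 2.
have : wedge_prod (to_wedge i s : wedge p0) i = wedge_prod (to_wedge j t : wedge p0) i.
  by rewrite st.
rewrite /wedge_prod !wedge_lift_funE; try exact: wedge_prod_pointE.
rewrite dfwithin; have [<-|ji] := eqVneq j i; first by rewrite dfwithin.
by rewrite dfwithout // => sE; rewrite sE eqxx in sp.
Qed.

Lemma to_wedge_surj (w : W) : exists i s, w = to_wedge i s.
Proof.
have : [set: W] w by [].
rewrite -(@wedgeTE 'I_N (fun=> sphere R 2) (fun=> pole R 2)).
by move=> [i _ [s _ <-]]; exists i, s.
Qed.

Lemma hausdorff_wedge : hausdorff_space W.
Proof.
apply: (@wedge_hausdorff 'I_N (fun=> sphere R 2)) => _.
by apply: hausdorff_set_type; exact: norm_hausdorff.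
Qed.

Definition quot (x : X') : W :=
  if [pick i | 0 < mu i (set_val x)] is Some i then to_wedge i (to_sphere i x)
  else to_wedge i0 (pole R 2).

Lemma quotE i (x : X') : (forall j, j != i -> mu j (set_val x) = 0) ->
  quot x = to_wedge i (to_sphere i x).
Proof.
move=> m0; rewrite /quot; case: pickP => [j mj|mi].
  have [->//|ji] := eqVneq j i; by rewrite m0 ?ltxx in mj.
rewrite to_sphere_pole; first exact: to_wedge_pole.
apply/eqP; rewrite eq_le leNgt mi mu_ge0 //.
by have [] := set_valP x.
Qed.

Lemma quot_L i (x : X') : geom L (set_val x) -> quot x = to_wedge i (pole R 2).
Proof.
move=> Lx; have m0 := (geomL_mu (set_valP x)).1 Lx.
by rewrite (@quotE i) ?to_sphere_pole.
Qed.

Lemma mu_cases (x : X') : geom L (set_val x) \/ exists i, 0 < mu i (set_val x).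
Proof.
have [|H] := pselect (exists i, 0 < mu i (set_val x)); [by right|left].
apply/(geomL_mu (set_valP x)) => i; apply/eqP.
rewrite eq_le mu_ge0 ?andbT; last by have [] := set_valP x.
by rewrite leNgt; apply/negP => mi; apply: H; exists i.
Qed.

(** Pasting over finitely many closed sets: the [i]-th one, where all other [mu j] vanish, is the
    triangle [i] together with [L], and there [quot] is given by the single formula of [quotE].
    Points of [L] alone are covered by the index [i0]. *)
Lemma cts_quot : continuous quot.
Proof.
apply/continuous_closedP => C cC.
have -> : quot @^-1` C = \bigcup_(i in [set: 'I_N])
    ((\bigcap_(j in [set j | j != i]) [set x | mu j (set_val x) <= 0]) `&`
     (to_wedge i \o to_sphere i) @^-1` C).
  have mle0 (x : X') j : (mu j (set_val x) <= 0) = (mu j (set_val x) == 0).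
    by rewrite eq_le mu_ge0 ?andbT; last by have [] := set_valP x.
  apply/seteqP; split => x /=.
    have [Lx|[i mi]] := mu_cases x => Cx.
      have m0 := (geomL_mu (set_valP x)).1 Lx.
      by exists i0 => //; split => [j _|] /=; rewrite ?m0 // -quotE.
    have mj j : j != i -> mu j (set_val x) = 0.
      exact: (mu_uniq (set_valP x) mi).
    by exists i => //; split => [j /mj|] /=; [rewrite mle0 => ->|rewrite -quotE].
  move=> [i _ [/= m0]]; rewrite -quotE // => j ji.
  by have := m0 j ji; rewrite /= mle0 => /eqP.
apply: closed_bigcup => [|i _]; first exact: finite_finset.
apply: closedI.
  apply: closed_bigI => j _; apply: closed_preimage_le.
  exact: (cts_comp (@cts_set_val _ _) (@cts_mu j)).
have : continuous (to_wedge i \o to_sphere i).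
  exact: (cts_comp (@cts_to_sphere i) (@cts_to_wedge i)).
by move/continuous_closedP; exact.
Qed.

Lemma quot_inj (x y : X') : quot x = quot y ->
  x = y \/ geom L (set_val x) /\ geom L (set_val y).
Proof.
have E z i : 0 < mu i (set_val z) -> quot z = to_wedge i (to_sphere i z).
  by move=> mi; apply: quotE => j; exact: (mu_uniq (set_valP z) mi).
have np z i : 0 < mu i (set_val z) -> to_sphere i z != pole R 2.
  by move=> mi; apply/eqP => /to_sphere_eq_pole m0; rewrite m0 ltxx in mi.
have [Lx|[i mx]] := mu_cases x; have [Ly|[j my]] := mu_cases y.
- by right.
- rewrite (quot_L j Lx) (E _ _ my) => /esym/to_wedge_inj/(_ (np _ _ my))[_ H].
  by have := np _ _ my; rewrite H eqxx.
- rewrite (quot_L i Ly) (E _ _ mx) => /to_wedge_inj/(_ (np _ _ mx))[_ H].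
  by have := np _ _ mx; rewrite H eqxx.
- rewrite (E _ _ mx) (E _ _ my) => /to_wedge_inj/(_ (np _ _ mx))[ij].
  by rewrite -ij in my * => /(to_sphere_inj mx my); left.
Qed.

Lemma quot_surj (e : E) : geom L e -> forall w, exists x, quot x = w.
Proof.
move=> Le w; have [i [s ->]] := to_wedge_surj w.
have [->|/(to_sphere_surj i)[x [mx <-]]] := eqVneq s (pole R 2).
  by exists (SigSub (mem_set (geomL_sub Le))); apply: quot_L.
by exists x; apply: quotE => j; exact: (mu_uniq (set_valP x) mx).
Qed.

(** Retraction of the line onto [0, 1]. It allows homotopies with values in [X'] to be defined for
    all real times, although [hep] preserves [geom L'] only for times in [0, 1]. *)
Definition clip (t : R) : R := Num.max 0 (Num.min 1 t).

Lemma cts_clip : continuous clip.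
Proof.
rewrite /clip; apply: cts_max; first exact: cts_cst.
by apply: cts_min; [exact: cts_cst|move=> x; exact: cvg_id].
Qed.

Lemma clip01 t : 0 <= clip t <= 1.
Proof. by rewrite /clip le_max lexx ge_max ler01 ge_min lexx. Qed.

Lemma clip_id t : 0 <= t <= 1 -> clip t = t.
Proof. by move=> /andP[t0 t1]; rewrite /clip (min_idPr _) // (max_idPr _). Qed.

Variables (K : simplicial_complex V) (e : E).
Hypothesis L'_sub : L' `<=` face K.
Hypothesis retracts_L' : retracts (@geom R V (face K)) (geom L').
Hypothesis retracts_L : retracts (@geom R V L) [set e].
Hypothesis geom_e : geom L e.

(** At time 1 the extended contraction is constant on [L], hence factors through [quot] as [g]. So
    [g] after [quot] is homotopic to the identity by [hep]. Since [hep] keeps [L] inside [L], it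
    also induces a homotopy on the wedge, from the identity to [quot] after [g]. The retraction [D]
    transports this from [X'] to the realization of [K]. *)
Theorem attach_triangles_wedge : homotopy_equivalent R (realization R K) W.
Proof.
have [h [cts_h h0 hL h1 _]] := retracts_L.
have [D [cts_D D0 DK D1 Dfix]] := retracts_L'.
pose X := realization R K.
have X'K : geom L' `<=` @geom R V (face K) by exact: geomS.
have clip0 : clip 0 = 0 by apply: clip_id; rewrite lexx ler01.
have clip1 : clip 1 = 1 by apply: clip_id; rewrite lexx ler01.
(* A section obtained by choice, in general not continuous. It occurs only in expressions whose
   value depends on the class of the point alone. *)
pose sec (w : W) : X' := projT1 (cid (quot_surj geom_e w)).
have secK w : quot (sec w) = w by rewrite /sec; case: cid.
have hepL' (x : X') t : geom L' (hep h (set_val x, clip t)).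
  by apply: (hep_L' h0 hL) => //; [exact: set_valP|exact: clip01].
pose hepX (z : X' * R) : X' := SigSub (mem_set (hepL' z.1 z.2)).
have cts_hepX : continuous hepX.
  apply: cts_set_type; apply: (cts_comp (g := hep h)); last exact: cts_hep.
  apply: cts_pair.
    exact: (cts_comp (@cts_fst _ _) (@cts_set_val _ _)).
  exact: (cts_comp (@cts_snd _ _) cts_clip).
have hepX0 x : hepX (x, 0) = x.
  apply: val_inj; rewrite /= clip0 hep0 //.
  by have [] := set_valP x.
have hepX_quot x y t : quot x = quot y -> quot (hepX (x, t)) = quot (hepX (y, t)).
  move=> /quot_inj[-> //|[Lx Ly]].
  rewrite !(@quot_L i0) // set_valE /=.
    by apply: (hep_L_stable hL) => //; exact: clip01.
  by apply: (hep_L_stable hL) => //; exact: clip01.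
have hepX1 x y : quot x = quot y -> hepX (x, 1) = hepX (y, 1).
  move=> /quot_inj[-> //|[Lx Ly]]; apply: val_inj.
  rewrite /= clip1 !hep_L //.
  by rewrite (h1 _ Lx) (h1 _ Ly).
have D1P (x : X) : geom L' (D (set_val x, 1)) by apply: D1; exact: set_valP.
pose rho (x : X) : X' := SigSub (mem_set (D1P x)).
have cts_rho : continuous rho.
  apply: cts_set_type; apply: (cts_comp (g := D)) => //; apply: cts_pair.
    exact: cts_set_val.
  exact: cts_cst.
pose inc (x : X') : X := SigSub (mem_set (X'K _ (set_valP x))).
have cts_inc : continuous inc by apply: cts_set_type; exact: cts_set_val.
have compX' : compact [set: X'] by apply/compact_set_type/geom_compact.
pose f := quot \o rho.
pose g w := inc (hepX (sec w, 1)).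
have gquot x : g (quot x) = inc (hepX (x, 1)) by rewrite /g (@hepX1 _ x).
exists f, g; split.
- exact: (cts_comp cts_rho cts_quot).
- apply: (quotient_continuous compX' hausdorff_wedge cts_quot (quot_surj geom_e)).
  rewrite (_ : g \o quot = fun x => inc (hepX (x, 1))).
    apply: (cts_comp _ cts_inc); apply: (cts_comp _ cts_hepX).
    by apply: cts_pair => [x|]; [exact: cvg_id|exact: cts_cst].
  by apply/funext => x /=; rewrite gquot.
(* The homotopy runs [D] and then [hep]; reversing time makes it start at [g \o f] and end at the
   identity. *)
- pose u (t : R) := 1 - clip t.
  have u01 t : 0 <= u t <= 1 by have := clip01 t; rewrite /u; lra.
  pose Phi (z : E * R) : E :=
    hep h (D (z.1, Num.min 1 (2 * z.2)), Num.max 0 (2 * z.2 - 1)).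
  have PhiK (x : X) t : geom (face K) (Phi (set_val x, u t)).
    have Kx := set_valP x; have := u01 t; move: (u t) => s /andP[s0 s1].
    rewrite /Phi /=; have [sh|sh] := lerP (2 * s) 1.
      rewrite (max_idPl _) ?subr_le0 // hep0 //; first by apply: DK => //; lra.
      by have [|] := DK _ (2 * s) Kx; first by lra.
    rewrite (max_idPr _); last by lra.
    by apply: (X'K); apply: (hep_L' h0 hL); [exact: D1|lra].
  exists (fun z => SigSub (mem_set (PhiK z.1 z.2))); split => [|x|x].
  + apply: continuous_subspaceT; apply: cts_set_type.
    apply: (cts_comp (g := hep h)); last exact: cts_hep.
    have cu : continuous (fun z : X * R => u z.2).
      apply: cts_add; first exact: cts_cst.
      by apply: cts_opp; exact: (cts_comp (@cts_snd _ _) cts_clip).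
    apply: cts_pair; last by cts.
    apply: (cts_comp (g := D)) => //; apply: cts_pair; last by cts.
    exact: (cts_comp (@cts_fst _ _) (@cts_set_val _ _)).
  + rewrite (gquot (rho x) : (g \o f) x = _); apply: val_inj.
    rewrite /= clip1 /u clip0 subr0 /Phi /= mulr1.
    rewrite (min_idPl _) ?ler1n // (max_idPr _); last by lra.
    by rewrite (_ : 2 - 1 = 1) //; lra.
  + apply: val_inj; rewrite /= /u clip1 subrr /Phi /= mulr0 (min_idPr _) // D0.
    rewrite sub0r (max_idPl _) ?lerN10 // hep0 //.
    by have [] := set_valP x.
(* Times are taken in the compact interval so that [quot] times the identity is a surjection from a
   compact space, through which the homotopy descends. *)
- pose I01 := set_type [set` `[(0 : R), 1]].
  have clipI t : [set` `[(0 : R), 1]] (clip t) by rewrite /= in_itv /= clip01.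
  pose toI t : I01 := SigSub (mem_set (clipI t)).
  pose psi (z : W * I01) : W := quot (hepX (sec z.1, 1 - set_val z.2)).
  have cts_psi : continuous psi.
    pose Q (z : X' * I01) : W * I01 := (quot z.1, z.2).
    apply: (@quotient_continuous _ _ _ Q).
    + by apply: compactT_prod => //; apply: compact_set_type; exact: segment_compact.
    + apply: hausdorff_prod; first exact: hausdorff_wedge.
      by apply: hausdorff_set_type; exact: norm_hausdorff.
    + apply: cts_pair; last exact: cts_snd.
      exact: (cts_comp (@cts_fst _ _) cts_quot).
    + move=> [w t]; have [x xw] := quot_surj geom_e w.
      by exists (x, t); rewrite /Q /= xw.
    + rewrite (_ : psi \o Q = fun z => quot (hepX (z.1, 1 - set_val z.2))).
        apply: (cts_comp _ cts_quot); apply: (cts_comp _ cts_hepX).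
        apply: cts_pair; first exact: cts_fst.
        apply: cts_add; first exact: cts_cst.
        by apply: cts_opp; exact: (cts_comp (@cts_snd _ _) (@cts_set_val _ _)).
      by apply/funext => -[x t]; apply: hepX_quot; rewrite secK.
  exists (fun z => psi (z.1, toI z.2)); split => [|w|w].
  + apply: continuous_subspaceT; apply: (cts_comp _ cts_psi).
    apply: cts_pair; first exact: cts_fst.
    by apply: cts_set_type; exact: (cts_comp (@cts_snd _ _) cts_clip).
  + rewrite /psi /f /= (_ : set_val (toI 0) = clip 0) // clip0 subr0.
    congr quot; apply: val_inj => /=; rewrite Dfix //.
    exact: hepL'.
  + by rewrite /psi /= (_ : set_val (toI 1) = clip 1) // clip1 subrr hepX0 secK.
Qed.

End quotient.

End attach_triangles.

(** * Retractions of the neighborhood complex of the cube *)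

Section cube_bits.
Variable n : nat.
Local Notation V := (n.-tuple bool).
Implicit Types (u v w : V) (a b c d x y : nat).
Local Open Scope nat_scope.

(* Bits are numbered from 1 to n, and index 0 stands for the zero vector: the
   closed ball around v consists of the [flip a v] for a = 0, ..., n. *)
Definition bit v b : bool := nth false (false :: v) b.

Definition flip a v : V := [tuple tnth v i (+) (a == i.+1) | i < n].

Lemma bit0 v : bit v 0 = false. Proof. by []. Qed.

Lemma bit_le v b : bit v b -> b <= n.
Proof.
by apply: contraTT; rewrite -ltnNge => nb; rewrite /bit nth_default //= size_tuple.
Qed.

Lemma bit_flip a v b : a <= n -> bit (flip a v) b = bit v b (+) ((a == b) && (0 < a)).
Proof.
move=> an; case: b => [|b]; first by rewrite !bit0; case: a an.
have [bn|nb] := ltnP b n.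
  have bitE w : bit w b.+1 = tnth w (Ordinal bn) by rewrite (tnth_nth false).
  by rewrite !bitE tnth_mktuple /=; case: a an => [|a] _ //=; rewrite andbT.
have -> : (a == b.+1) = false by apply/eqP; lia.
rewrite addbF; have out w : bit w b.+1 = false by rewrite /bit /= nth_default ?size_tuple.
by rewrite !out.
Qed.

Lemma bit_inj u v : (forall b, bit u b = bit v b) -> u = v.
Proof.
by move=> uv; apply: eq_from_tnth => i; rewrite !(tnth_nth false); exact: (uv i.+1).
Qed.

Definition origin : V := [tuple of nseq n false].

Lemma bit_origin b : bit origin b = false.
Proof. by rewrite /bit; case: b => // b /=; rewrite nth_nseq if_same. Qed.

Lemma flip0 v : flip 0 v = v.
Proof. by apply: bit_inj => b; rewrite bit_flip // andbF addbF. Qed.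

Lemma flipK a v : a <= n -> flip a (flip a v) = v.
Proof. by move=> an; apply: bit_inj => b; rewrite !bit_flip // addbK. Qed.

Lemma flipC a b v : a <= n -> b <= n -> flip a (flip b v) = flip b (flip a v).
Proof. by move=> an bn; apply: bit_inj => c; rewrite !bit_flip // addbAC. Qed.

Lemma flip_eq a b v w : a <= n -> flip a v = flip b w -> v = flip a (flip b w).
Proof. by move=> an <-; rewrite flipK. Qed.

Lemma flip_inj a b v : a <= n -> b <= n -> flip a v = flip b v -> a = b.
Proof.
move=> an bn ab; have H c : bit (flip a v) c = bit (flip b v) c by rewrite ab.
have := H a; have := H b; rewrite !bit_flip //.
case: (bit v a); case: (bit v b); rewrite !eqxx /= ?(eq_sym b a);
  case: (a =P b) => //=; lia.
Qed.

(** The Sidon property of e_0 = 0, e_1, ..., e_n, read off from the bits at the four indices; the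
    first alternative is the case where both sums are 0. *)
Lemma flip2 a b c d v : a <= n -> b <= n -> c <= n -> d <= n -> a <> b ->
  flip c (flip a v) = flip d (flip b v) -> (c = a /\ d = b) \/ (c = b /\ d = a).
Proof.
move=> an bn cn dn ab E; have H x : bit (flip c (flip a v)) x =
  bit (flip d (flip b v)) x by rewrite E.
have := H a; have := H b; have := H c; have := H d; rewrite !bit_flip //.
rewrite -!addbA => /addbI E1 /addbI E2 /addbI E3 /addbI E4; move: E1 E2 E3 E4; rewrite !eqxx.
rewrite ?(eq_sym b a) ?(eq_sym c a) ?(eq_sym d a) ?(eq_sym c b) ?(eq_sym d b) ?(eq_sym d c).
by case: (a =P b) => //; case: (a =P c); case: (a =P d); case: (b =P c);
  case: (b =P d); case: (c =P d) => /=; lia.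
Qed.

Definition top v : nat := \max_(b < n.+1 | bit v b) b.

Lemma top_le v : top v <= n.
Proof. by apply/bigmax_leqP => b _; rewrite -ltnS. Qed.

Lemma bit_top_le v b : bit v b -> b <= top v.
Proof.
move=> vb; have bn : b < n.+1 by rewrite ltnS (bit_le vb).
exact: (@leq_bigmax_cond _ (fun c : 'I_n.+1 => bit v c) (@nat_of_ord _) (Ordinal bn)).
Qed.

Lemma bit_top v : 0 < top v -> bit v (top v).
Proof.
move=> v0; have [b vb|nv] := pickP (fun b : 'I_n.+1 => bit v b); last first.
  by move: v0; rewrite /top big_pred0.
have c0 : 0 < #|[pred b : 'I_n.+1 | bit v b]| by apply/card_gt0P; exists b.
have [c vc cE] := eq_bigmax_cond (@nat_of_ord n.+1) c0.
by rewrite (cE : top v = c).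
Qed.

Lemma top_eq0 v : (top v == 0) = (v == origin).
Proof.
apply/eqP/eqP => [v0|->].
  apply: bit_inj => b; rewrite bit_origin; apply/negbTE/negP => vb.
  by have := bit_top_le vb; rewrite v0; case: b vb.
by apply/eqP; rewrite -leqn0; apply/bigmax_leqP => b; rewrite bit_origin.
Qed.

Definition apex v : V := flip (top v) v.

Definition ball v : {set V} := [set u | [exists a : 'I_n.+1, u == flip a v]]%SET.

Lemma ballP u v : reflect (exists2 a, a <= n & u = flip a v) (u \in ball v).
Proof.
rewrite inE; apply: (iffP existsP) => [[a /eqP ->]|[a an ->]].
  by exists (a : nat); rewrite // -ltnS.
have an' : a < n.+1 by [].
by exists (Ordinal an').
Qed.

Lemma flip_ball a v : a <= n -> flip a v \in ball v.
Proof. by move=> an; apply/ballP; exists a. Qed.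

Lemma apex_ball v : apex v \in ball v.
Proof. exact/flip_ball/top_le. Qed.

(** Were the centers distinct, [flip2] would give [flip a v] the index b in the ball of [u], by
    comparison with [flip b v], and likewise the index d. *)
Lemma ball_triple a b d u v : a <= n -> b <= n -> d <= n ->
  a <> b -> a <> d -> b <> d ->
  flip a v \in ball u -> flip b v \in ball u -> flip d v \in ball u -> u = v.
Proof.
move=> an bn dn ab ad bd /ballP[a' a'n Ea] /ballP[b' b'n Eb] /ballP[d' d'n Ed].
have {}Ea := flip_eq a'n (esym Ea); have {}Eb := flip_eq b'n (esym Eb).
have {}Ed := flip_eq d'n (esym Ed).
have [[aa _]|[ab' _]] := flip2 an bn a'n b'n ab (etrans (esym Ea) Eb).
  by rewrite Ea aa flipK.
have [[aa _]|[ad' _]] := flip2 an dn a'n d'n ad (etrans (esym Ea) Ed).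
  by rewrite Ea aa flipK.
by case: bd; rewrite -ab' -ad'.
Qed.

(* The weight of index 0 is 0, since it does not change the vertex. *)
Definition weight a := if a == 0 then 0 else 2 ^ a.

Definition rank v := \sum_(b < n.+1 | bit v b) weight b.

Lemma weight_lt a b : a < b -> weight a < weight b.
Proof.
rewrite /weight; case: b => // b; case: a => [_|a ab] /=; first by rewrite expn_gt0.
by rewrite ltn_exp2l.
Qed.

Lemma rank_flipN a v : a <= n -> ~~ bit v a -> rank (flip a v) = rank v + weight a.
Proof.
case: a => [|a] an va; first by rewrite flip0 addn0.
have an' : a.+1 < n.+1 by [].
rewrite /rank (bigD1 (Ordinal an')) /=; last by rewrite bit_flip // eqxx addbT.
rewrite addnC; congr (_ + _); apply: eq_bigl => b; rewrite bit_flip //= andbT.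
have [->|nb] := eqVneq b (Ordinal an') => /=; first by rewrite andbF (negbTE va).
have -> : (a.+1 == b) = false by move: nb; rewrite -val_eqE /= eq_sym => /negbTE.
by rewrite addbF andbT.
Qed.

Lemma rank_flip a v : bit v a -> rank v = rank (flip a v) + weight a.
Proof.
move=> va; have an := bit_le va; rewrite -{1}[v](flipK v an) rank_flipN //.
rewrite bit_flip // eqxx va /=; case: a va an => //.
Qed.

(** [flip d u] has highest bit d, and among the centers of the balls containing it, erasing that bit
    yields the unique one of least rank. *)
Lemma rank_flip_top u v d x : top u < d <= n -> x <= n -> flip d u = flip x v ->
  rank u < rank v \/ x = d.
Proof.
move=> /andP[ud dn] xn E; set w := flip d u.
have ubd b : d <= b -> bit u b = false.
  by move=> db; apply/negbTE/negP => /bit_top_le; lia.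
have ru : rank w = rank u + weight d by rewrite rank_flipN ?ubd.
have wd : 0 < weight d by have := @weight_lt 0 d; rewrite /weight /=; lia.
have vE : v = flip x w by rewrite /w E flipK.
have [wx|wx] := boolP (bit w x); last by left; rewrite vE rank_flipN //; lia.
have xd : x <= d.
  rewrite leqNgt; apply/negP => dx; move: wx; rewrite bit_flip //.
  by rewrite ubd ?(ltnW dx) // (ltn_eqF dx).
have := rank_flip wx; rewrite -vE ru.
have [->|xd'] := eqVneq x d; first by right.
by have := @weight_lt x d; left; lia.
Qed.

(** The greater index decides, whichever way bit a changes. Of the two balls that share an edge, the
    one whose center lacks the greater bit thus has the smaller center. *)
Lemma rank_flip2 a b v : a < b <= n -> ~~ bit v b ->
  rank v < rank (flip a (flip b v)).
Proof.
move=> /andP[ab bn] vb; have an : a <= n by lia.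
have := rank_flipN bn vb; have := weight_lt ab.
have [va|va] := boolP (bit (flip b v) a); first by have := rank_flip va; lia.
by have := rank_flipN an va; lia.
Qed.

Lemma rank_flip2_bit a b v : a < b <= n -> bit v b -> rank (flip a (flip b v)) < rank v.
Proof.
move=> /andP[ab bn] vb; have an : a <= n by lia.
have {2}-> : v = flip a (flip b (flip a (flip b v))).
  by rewrite (flipC _ bn an) flipK // flipK.
apply: rank_flip2; first by rewrite ab.
by rewrite !bit_flip // (ltn_eqF ab) eqxx vb /=; lia.
Qed.

(** * Reduction to cones over edges *)

Definition ball_face : set {set V} :=
  [set t | t != finset.set0 /\ exists v, t \subset ball v].

Lemma ball_face_closed : subset_closed ball_face.
Proof.
move=> s t [_ [v sv]] t0 ts; split => //; exists v.
exact: fintype.subset_trans ts sv.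
Qed.

Local Notation idx2 := (V * 'I_n.+1 * 'I_n.+1)%type.
Local Notation idx3 := (V * 'I_n.+1 * 'I_n.+1 * 'I_n.+1)%type.

Lemma idx_le (a : 'I_n.+1) : a <= n. Proof. by rewrite -ltnS. Qed.
Hint Resolve idx_le top_le : core.

Definition off_apex : {set idx3} :=
  [set i : idx3 | let: (v, a, b, d) := i in
    [&& a != b, a != d, b != d, a != top v :> nat, b != top v :> nat
      & d != top v :> nat]]%SET.

Definition off_apex_face (i : idx3) : {set V} :=
  let: (v, a, b, d) := i in [set flip a v; flip b v; flip d v]%SET.

Definition off_apex_apex (i : idx3) : V :=
  let: (v, a, b, d) := i in apex v.

Definition coned := avoid ball_face off_apex_face off_apex.

Lemma flip_neq a b v : a <= n -> b <= n -> a <> b -> flip a v != flip b v.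
Proof. by move=> an bn ab; apply/eqP => /flip_inj; auto. Qed.

Lemma flip_apex a v : a <= n -> (flip a v == apex v) = (a == top v).
Proof.
move=> an; apply/eqP/eqP => [/flip_inj|->//]; exact.
Qed.

Lemma off_apexP v (a b d : 'I_n.+1) : (v, a, b, d) \in off_apex ->
  [/\ nat_of_ord a <> b, nat_of_ord a <> d, nat_of_ord b <> d
    & [/\ nat_of_ord a <> top v, nat_of_ord b <> top v & nat_of_ord d <> top v]].
Proof.
rewrite inE => /and5P[/eqP ab /eqP ad /eqP bd /eqP at_ /andP[/eqP bt /eqP dt]].
by do !split => //; move/val_inj.
Qed.

Lemma off_apex_ball v (a b d : 'I_n.+1) u : (v, a, b, d) \in off_apex ->
  off_apex_face (v, a, b, d) \subset ball u -> u = v.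
Proof.
move=> /off_apexP[ab ad bd _] /fintype.subsetP sub.
apply: (@ball_triple a b d) => //; apply: sub; rewrite !inE eqxx ?orbT //.
Qed.

Lemma apex_off_apex v (a b d : 'I_n.+1) : (v, a, b, d) \in off_apex ->
  apex v \notin off_apex_face (v, a, b, d).
Proof.
move=> /off_apexP[_ _ _ [at_ bt dt]].
by rewrite !inE ![apex v == _]eq_sym !flip_apex // !negb_or; apply/andP; split;
  [apply/andP; split|]; apply/eqP.
Qed.

(** All keys are equal because the order is immaterial: a triple determines its ball by
    [ball_triple], and the apex of that ball lies in none of the triples to be removed from it. *)
Lemma retracts_coned (R : realType) :
  retracts (@geom R V ball_face) (geom coned).
Proof.
apply: (@collapse_family _ _ _ _ _ _ off_apex_apex (fun=> 0)).
- exact: ball_face_closed.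
- by move=> [[[v a] b] d] _; apply/set0Pn; exists (flip a v); rewrite !inE eqxx.
- by move=> [[[v a] b] d]; exact: apex_off_apex.
- move=> [[[v a] b] d] t iP [t0 [u tu]] it _.
  have uv : u = v by apply: off_apex_ball iP _; exact: fintype.subset_trans it tu.
  rewrite uv in tu; have vt : (apex v |: t)%SET \subset ball v.
    by rewrite finset.subUset finset.sub1set apex_ball.
  split.
    by split; [apply/set0Pn; exists (apex v); rewrite !inE eqxx|exists v].
  move=> [[[v' a'] b'] d'] jP _ _ jt.
  have vv' : v = v' by apply: off_apex_ball jP _; exact: fintype.subset_trans jt vt.
  rewrite -vv' in jP jt *; have napex := apex_off_apex jP.
  apply/fintype.subsetP => w wj; move/fintype.subsetP: jt => /(_ w wj).
  by rewrite in_setU1 => /orP[/eqP wE|//]; move: napex; rewrite -[apex v]wE wj.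
Qed.

Definition edge v a b : {set V} := [set flip a v; flip b v]%SET.
Definition triangle v a b : {set V} := [set apex v; flip a v; flip b v]%SET.

Lemma in_triangle v a b w :
  (w \in triangle v a b) = [|| w == apex v, w == flip a v | w == flip b v].
Proof. by rewrite !inE orbA. Qed.

Lemma ball_face_small t : ball_face t -> #|t| <= 2 -> coned t.
Proof.
move=> Ft t2; split => // -[[[v a] b] d] /off_apexP[ab ad bd _].
apply/negP => /subset_leq_card; rewrite /= card_set3 ?flip_neq //.
by move=> t3; have := leq_trans t3 t2.
Qed.

Lemma edge_face v a b : a <= n -> b <= n -> ball_face (edge v a b).
Proof.
move=> an bn; split; first by apply/set0Pn; exists (flip a v); rewrite !inE eqxx.
by exists v; rewrite finset.subUset !finset.sub1set !flip_ball.
Qed.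

Lemma card_triangle v a b : a <= n -> b <= n -> a <> b -> a <> top v ->
  b <> top v -> #|triangle v a b| = 3.
Proof.
by move=> an bn ab at_ bt; rewrite card_set3 ?flip_neq // => E; [apply: at_|apply: bt].
Qed.

Lemma triangle_ball v a b : a <= n -> b <= n -> triangle v a b \subset ball v.
Proof.
move=> an bn; apply/fintype.subsetP => w; rewrite in_triangle.
by move=> /or3P[] /eqP ->; [exact: apex_ball|exact: flip_ball|exact: flip_ball].
Qed.

Lemma triangle_inj v a b u : a <= n -> b <= n -> a <> b -> a <> top v ->
  b <> top v -> triangle v a b \subset ball u -> u = v.
Proof.
move=> an bn ab at_ bt /fintype.subsetP sub.
have ta : top v <> a by move=> E; apply: at_.
have tb : top v <> b by move=> E; apply: bt.
by apply: (@ball_triple (top v) a b) => //; apply: sub; rewrite in_triangle eqxx ?orbT.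
Qed.

Lemma triangle_coned v a b : a <= n -> b <= n -> a <> b -> a <> top v ->
  b <> top v -> coned (triangle v a b).
Proof.
move=> an bn ab at_ bt; split.
  split; first by apply/set0Pn; exists (apex v); rewrite !inE eqxx.
  by exists v; exact: triangle_ball.
move=> [[[u c] d] f] iP; apply/negP => sub.
have uv : v = u.
  by apply: off_apex_ball iP _; exact: fintype.subset_trans sub (triangle_ball _ _ _).
have := apex_off_apex iP; rewrite -uv; apply/negP; rewrite negbK.
have [cd cf df _] := off_apexP iP.
have -> : off_apex_face (v, c, d, f) = triangle v a b.
  apply/eqP; rewrite eqEcard -uv in sub *; rewrite sub card_triangle //.
  by rewrite card_set3 ?flip_neq.
by rewrite in_triangle eqxx.
Qed.

(** From n >= 2 there are three indices 0, 1, 2. This serves to enlarge small faces to triangles. *)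
Lemma exists_index c d : 2 <= n -> exists a : 'I_n.+1, nat_of_ord a <> c /\ nat_of_ord a <> d.
Proof.
move=> n2; have [a [an ac ad]] : exists a, [/\ a < n.+1, a <> c & a <> d].
  exists (if (0 != c) && (0 != d) then 0 else
          if (1 != c) && (1 != d) then 1 else 2).
  by case: ifP => H0; [|case: ifP => H1]; split; lia.
by exists (Ordinal an).
Qed.

Lemma coned_sub t : 2 <= n -> coned t -> exists v (a b : 'I_n.+1),
  [/\ a < b, nat_of_ord a <> top v, nat_of_ord b <> top v & t \subset triangle v a b].
Proof.
move=> n2 [[t0 [v tv]] tP].
suff [a [b [ab at_ bt tab]]] : exists a b : 'I_n.+1, [/\ nat_of_ord a <> b,
    nat_of_ord a <> top v, nat_of_ord b <> top v & t \subset triangle v a b].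
  have [lt|ge] := ltnP a b; first by exists v, a, b.
  exists v, b, a; split => //; first by rewrite ltn_neqAle ge andbT; apply/eqP; lia.
  by apply: fintype.subset_trans tab _; rewrite /triangle finset.setUAC.
(* The indices of [t] off the apex. There are at most two of them, since a third would give a
   removed triple; missing ones are chosen arbitrarily. *)
pose S := [set a : 'I_n.+1 | (flip a v \in t) && (a != top v :> nat)]%SET.
have tS (a b : 'I_n.+1) : (forall d : 'I_n.+1, d \in S -> d = a \/ d = b) -> t \subset triangle v a b.
  move=> Sab; apply/fintype.subsetP => w wt.
  have /fintype.subsetP/(_ w wt)/ballP[d dn wE] := tv.
  have dn' : d < n.+1 by [].
  rewrite in_triangle wE flip_apex //; case: eqP => //= dt.
  have [|<-|<-] := Sab (Ordinal dn'); rewrite ?eqxx ?orbT //.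
  by rewrite inE /= -wE wt; apply/eqP.
have [S0|/set0Pn[a aS]] := eqVneq S finset.set0.
  have [a [at_ _]] := exists_index (top v) 0 n2.
  have [b [bt ba]] := exists_index (top v) a n2.
  exists a, b; split => //; first by move=> E; apply: ba.
  by apply: tS => d; rewrite S0 inE.
have [at_ avt] : nat_of_ord a <> top v /\ flip a v \in t.
  by move: aS; rewrite inE => /andP[-> /eqP].
have [Sa0|/set0Pn[b]] := eqVneq (S :\ a)%SET finset.set0.
  have [b [bt ba]] := exists_index (top v) a n2.
  exists a, b; split => //; first by move=> E; apply: ba.
  apply: tS => d dS; left; apply/eqP; apply: contraT => da.
  by have : d \in (S :\ a)%SET; [rewrite in_setD1 da|rewrite Sa0 inE].
rewrite 3!inE => /andP[ba /andP[bvt /eqP bt]].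
exists a, b; split => //; first by move=> /val_inj E; rewrite E eqxx in ba.
apply: tS => d; rewrite inE => /andP[dvt /eqP dt].
have [->|da] := eqVneq d a; first by left.
have [->|db] := eqVneq d b; first by right.
have : (v, a, b, d) \in off_apex.
  rewrite inE (eq_sym a) ba (eq_sym a) da (eq_sym b) db /=.
  by apply/and3P; split; apply/eqP.
move=> /tP /negP[]; apply/fintype.subsetP => w.
by rewrite !inE => /orP[/orP[]|] /eqP ->.
Qed.

(** * Critical triangles and the collapse of the remaining complex *)

Definition critical : {set idx2} :=
  [set i : idx2 | let: (v, a, b) := i in [&& a < b, b < top v & bit v b]]%SET.

Definition triangle_of (i : idx2) : {set V} := let: (v, a, b) := i in triangle v a b.

Definition spine : set {set V} :=
  [set t | coned t /\ forall i, i \in critical -> t <> triangle_of i].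

Lemma triangle_eq v a b u c d : a <= n -> b <= n -> c <= n -> d <= n ->
  a < b -> a <> top v -> b <> top v -> c < d -> c <> top u -> d <> top u ->
  triangle v a b = triangle u c d -> [/\ u = v, c = a & d = b].
Proof.
move=> an bn cn dn ab at_ bt cd ct dt E.
have uv : u = v.
  apply: (@triangle_inj v a b) => //; first by lia.
  by rewrite E; exact: triangle_ball.
rewrite uv in E ct dt *; split => //.
all: have : flip c v \in triangle v a b by rewrite E in_triangle eqxx !orbT.
all: have : flip d v \in triangle v a b by rewrite E in_triangle eqxx !orbT.
all: rewrite !in_triangle !flip_apex // => /or3P[] /eqP // D /or3P[] /eqP // C.
all: have := flip_inj dn _ D; have := flip_inj cn _ C; lia.
Qed.

Lemma coned_card t : 2 <= n -> coned t -> #|t| <= 3.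
Proof.
move=> n2 /(coned_sub n2)[v [a [b [ab at_ bt /subset_leq_card]]]].
by rewrite card_triangle //; lia.
Qed.

Lemma criticalP v (a b : 'I_n.+1) : (v, a, b) \in critical ->
  [/\ a < b, nat_of_ord a <> top v, nat_of_ord b <> top v & bit v b].
Proof. by rewrite inE => /and3P[ab bt vb]; split => //; lia. Qed.

Lemma card_triangle_of i : i \in critical -> #|triangle_of i| = 3.
Proof.
by case: i => -[v a] b /criticalP[ab at_ bt vb]; rewrite card_triangle //; lia.
Qed.

Lemma triangle_of_inj : {in critical &, injective triangle_of}.
Proof.
move=> [[v a] b] [[u c] d] /criticalP[ab at_ bt _] /criticalP[cd ct dt _] /= E.
have [-> /val_inj -> /val_inj ->] // := triangle_eq (idx_le a) (idx_le b)
  (idx_le c) (idx_le d) ab at_ bt cd ct dt E.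
Qed.

Lemma spine_small t : ball_face t -> #|t| <= 2 -> spine t.
Proof.
move=> Ft t2; split; first exact: ball_face_small.
by move=> i /card_triangle_of i3 E; rewrite E i3 in t2.
Qed.

(** Critical triangles are maximal, since faces of [coned] have at most three vertices. *)
Lemma spine_closed : 2 <= n -> subset_closed spine.
Proof.
move=> n2 s t [Fs sN] t0 ts; split.
  by move: Fs t0 ts; apply: avoid_closed; exact: ball_face_closed.
move=> i ic E; apply: (sN i ic); rewrite -E; apply/eqP; rewrite eq_sym eqEcard ts.
by rewrite E card_triangle_of // coned_card.
Qed.

Lemma spine_cases t : 2 <= n -> spine t -> #|t| <= 2 \/ exists v (a b : 'I_n.+1),
  [/\ a < b, nat_of_ord a <> top v, nat_of_ord b <> top v, ~~ bit v b
    & t = triangle v a b].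
Proof.
move=> n2 [/(coned_sub n2)[v [a [b [ab at_ bt tab]]]] tN].
have [t2|t3] := leqP #|t| 2; [by left|right].
have E : t = triangle v a b.
  by apply/eqP; rewrite eqEcard tab card_triangle //; lia.
exists v, a, b; split => //; apply/negP => vb; apply: (tN (v, a, b)) => //.
by rewrite inE ab vb andbT /= ltn_neqAle bit_top_le // andbT; apply/eqP.
Qed.

(** The lower cells of the matching. A pair a < b stands for an edge written with its smaller
    center; a pair a = b > [top v] stands for the single vertex [flip b v], because [edge v b b] is
    a singleton. *)
Definition free : {set idx2} := [set i : idx2 | let: (v, a, b) := i in
  [&& a < b, a != top v :> nat & ~~ bit v b] || (a == b) && (top v < b)]%SET.

Definition free_face (i : idx2) : {set V} := let: (v, a, b) := i in edge v a b.
Definition free_apex (i : idx2) : V := let: (v, a, b) := i in apex v.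
(** Centers are treated in decreasing order, and for each center the edges, with odd keys, precede
    the vertices, with even keys. *)
Definition free_key (i : idx2) : nat :=
  let: (v, a, b) := i in (rank v).*2 + (a != b).

Lemma freeP v (a b : 'I_n.+1) : (v, a, b) \in free ->
  [/\ a < b, nat_of_ord a <> top v, nat_of_ord b <> top v, ~~ bit v b &
      free_key (v, a, b) = (rank v).*2.+1] \/
  [/\ a = b, top v < b & free_key (v, a, b) = (rank v).*2].
Proof.
rewrite inE /free_key => /orP[/and3P[ab /eqP at_ vb]|/andP[/eqP -> tb]]; last first.
  by right; rewrite eqxx addn0.
left; split => //; last first.
  by rewrite -val_eqE /= (ltn_eqF ab) addn1.
(* Here b > a >= 0, so b = [top v] would be a positive index and hence a bit of [v]. *)
by move=> bt; move: vb; rewrite bt => /negP[]; apply: bit_top; lia.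
Qed.

Lemma free_edge v a b : a <= n -> b <= n -> a < b -> a <> top v -> ~~ bit v b ->
  exists i, [/\ i \in free, free_face i = edge v a b & free_key i = (rank v).*2.+1].
Proof.
move=> an bn ab at_ vb; have an' : a < n.+1 by []. have bn' : b < n.+1 by [].
exists (v, Ordinal an', Ordinal bn'); split => //.
  by rewrite inE /= ab vb; move/eqP: at_ => ->.
by rewrite /free_key -val_eqE /= (ltn_eqF ab) addn1.
Qed.

Lemma free_vertex v b : b <= n -> top v < b ->
  exists i, [/\ i \in free, free_face i = [set flip b v]%SET & free_key i = (rank v).*2].
Proof.
move=> bn tb; have bn' : b < n.+1 by [].
exists (v, Ordinal bn', Ordinal bn'); split => //.
- by rewrite inE eqxx /= tb orbT.
- by rewrite /= /edge finset.setUid.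
- by rewrite /free_key eqxx addn0.
Qed.

(** The two balls containing the edge have centers that differ by e_x + e_y, hence in the bit
    [maxn x y]; the one without this bit is taken. *)
Lemma edge_normal u w z : u \in ball z -> w \in ball z -> u <> w ->
  exists v x y, [/\ x <= n, y <= n, x <> y, ~~ bit v (maxn x y) &
    u = flip x v /\ w = flip y v].
Proof.
move=> /ballP[x xn uE] /ballP[y yn wE] uw.
have xy : x <> y by move=> xy; apply: uw; rewrite uE wE xy.
have [zb|zb] := boolP (bit z (maxn x y)); last by exists z, x, y.
exists (flip x (flip y z)), y, x; split => //; first by move=> E; apply: xy.
  rewrite maxnC !bit_flip // zb.
  by case: (x =P maxn x y); case: (y =P maxn x y) => /=; lia.
by rewrite (flipC _ xn yn) flipK // (flipC _ yn xn) flipK.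
Qed.

Lemma edge_in_ball u v c d x y : c <= n -> d <= n -> x <= n -> y <= n -> x <> y ->
  flip c u = flip x v -> flip d u = flip y v ->
  [/\ u = v, c = x & d = y] \/ [/\ u = flip c (flip d v), c = y & d = x].
Proof.
move=> cn dn xn yn xy Ec Ed.
have {}Ec := flip_eq cn Ec; have {}Ed := flip_eq dn Ed.
have [[cx dy]|[cy dx]] := flip2 xn yn cn dn xy (etrans (esym Ec) Ed).
  by left; split => //; rewrite Ec cx flipK.
by right; split => //; rewrite dx.
Qed.

(** A triangle of the spine over this edge that is not centered at [v] is centered at v + e_a + e_b,
    which has greater rank. Not being critical, it has a base that is a free edge of greater key,
    which [high] excludes. *)
Lemma free_edge_cone v (a b : 'I_n.+1) t : 2 <= n ->
  a < b -> nat_of_ord a <> top v -> nat_of_ord b <> top v -> ~~ bit v b ->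
  spine t -> edge v a b \subset t ->
  (forall j, j \in free -> (rank v).*2.+1 < free_key j -> ~~ (free_face j \subset t)) ->
  (apex v |: t)%SET = triangle v a b.
Proof.
move=> n2 ab at_ bt vb St /[dup] abt /fintype.subsetP abt' high.
have avt : flip a v \in t by apply: abt'; rewrite !inE eqxx.
have bvt : flip b v \in t by apply: abt'; rewrite !inE eqxx orbT.
have [t2|[u [c [d [cd ct dt ud tE]]]]] := spine_cases n2 St.
  have -> : t = edge v a b.
    apply/esym/eqP; rewrite eqEcard abt cards2 flip_neq //; lia.
  by rewrite /edge finset.setUA.
have tu : t \subset ball u by rewrite tE triangle_ball.
move/fintype.subsetP: (tu) => tu'.
have /ballP[x xn Ea] := tu' _ avt; have /ballP[y yn Eb] := tu' _ bvt.
have xy : x <> y.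
  by move=> xy; rewrite xy -Eb in Ea; have := flip_inj (idx_le a) (idx_le b) Ea; lia.
have [[vu ax by_]|[vE ay bx]] := edge_in_ball (idx_le a) (idx_le b) xn yn xy Ea Eb.
  have uE := esym vu; rewrite uE in tE ct dt ud *.
  move: avt bvt; rewrite tE !in_triangle !flip_apex //.
  move=> /or3P[] /eqP // A /or3P[] /eqP // B.
  - have := flip_inj (idx_le a) (idx_le c) A; have := flip_inj (idx_le b) (idx_le c) B; lia.
  - rewrite (flip_inj (idx_le a) (idx_le c) A) (flip_inj (idx_le b) (idx_le d) B).
    by apply/finset.setUidPr; rewrite finset.sub1set in_triangle eqxx.
  - have := flip_inj (idx_le a) (idx_le d) A; have := flip_inj (idx_le b) (idx_le c) B; lia.
  - have := flip_inj (idx_le a) (idx_le d) A; have := flip_inj (idx_le b) (idx_le d) B; lia.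
have uE : u = flip a (flip b v).
  by rewrite vE (flipC _ (idx_le b) (idx_le a)) flipK // flipK.
have ruv : rank v < rank u by rewrite uE; apply: rank_flip2 => //; rewrite ab idx_le.
have [j [jf jE jk]] := free_edge (idx_le c) (idx_le d) cd ct ud.
have := high j jf; rewrite jk jE => /(_ _)/negP[]; first by lia.
by rewrite tE; apply/fintype.subsetP => w; rewrite !inE => /orP[] ->; rewrite ?orbT.
Qed.

(** A further vertex of [t] would span an edge with [flip b v]. Its smaller center has rank at least
    that of [v], so [high] forbids it to be a free edge and the edge has to pass through the apex of
    its center. *)
Lemma free_vertex_cone v b t : b <= n -> top v < b -> spine t -> flip b v \in t ->
  (forall j, j \in free -> (rank v).*2 < free_key j -> ~~ (free_face j \subset t)) ->
  (apex v |: t)%SET = edge v (top v) b.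
Proof.
move=> bn tb St bvt high; have [[[_ [z tz]] _] _] := St.
apply/eqP; rewrite finset.eqEsubset; apply/andP; split; last first.
  by apply/fintype.subsetP => w; rewrite !inE => /orP[]/eqP ->; rewrite ?eqxx // bvt orbT.
apply/fintype.subsetP => w; rewrite in_setU1 in_set2 -/(apex v).
case: (w =P apex v) => //= wa wt; case: (w =P flip b v) => // wb; exfalso.
move/fintype.subsetP: tz => tz.
have [z' [x [y [xn yn xy zxy [wE bE]]]]] := edge_normal (tz _ wt) (tz _ bvt) wb.
have edge_t lo hi : (lo = x /\ hi = y) \/ (lo = y /\ hi = x) ->
    edge z' lo hi \subset t.
  by move=> [] [-> ->]; apply/fintype.subsetP => s; rewrite !inE => /orP[] /eqP ->;
    rewrite -?wE -?bE.
have [lo [hi [loE lohi hixy]]] : exists lo hi,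
    [/\ (lo = x /\ hi = y) \/ (lo = y /\ hi = x), lo < hi & hi = maxn x y].
  have [lt|ge] := ltnP x y; first by exists x, y; split; [left| |lia].
  by exists y, x; split; [right|lia|lia].
have lon : lo <= n by case: loE => -[-> _].
have hin : hi <= n by case: loE => -[_ ->].
rewrite -hixy in zxy.
have no_edge : rank v <= rank z' -> lo = top z'.
  move=> le; apply: contrapT => lot.
  have [j [jf jE jk]] := free_edge lon hin lohi lot zxy.
  have := high j jf; rewrite jk jE edge_t // => /(_ _)/negP[] //; lia.
(* If the center [z'] has greater rank than [v], the end of the edge away from its apex is a free
   vertex of greater key. Otherwise the center is [v] and the other end is [apex v]. *)
have [lt|yb] := @rank_flip_top v z' b y (introT andP (conj tb bn)) yn bE.
  have lot := no_edge (ltnW lt).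
  have [j [jf jE jk]] := @free_vertex z' hi hin (ltac:(lia)).
  have := high j jf; rewrite jk jE => /(_ _)/negP[]; first by lia.
  apply: fintype.subset_trans (edge_t lo hi loE).
  by apply/fintype.subsetP => s; rewrite !inE => ->; rewrite orbT.
have vz : z' = v.
  by rewrite -(flipK z' yn) -bE yb flipK.
rewrite vz in no_edge wE; have lot := no_edge (leqnn _).
apply: wa; rewrite wE; congr flip; lia.
Qed.

Lemma free_higher v (c d : 'I_n.+1) u x : (u, c, d) \in free -> c = d ->
  x <= n -> flip d u = flip x v -> rank u < rank v \/ [/\ u = v & nat_of_ord d = x].
Proof.
move=> /freeP[[+ _ _ _ _] cd|[_ td _] _]; first by rewrite cd ltnn.
move=> xn E; have tdn : top u < d <= n by rewrite td idx_le.
have [|xd] := rank_flip_top tdn xn E; first by left.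
right; split => //; rewrite xd in E.
by rewrite -[u](flipK u (idx_le d)) E flipK.
Qed.

Lemma retracts_spine (R : realType) : 2 <= n ->
  retracts (@geom R V spine) (geom (avoid spine free_face free)).
Proof.
move=> n2; apply: (@collapse_family _ _ _ _ _ _ free_apex free_key).
- exact: spine_closed.
- by move=> [[v a] b] _; apply/set0Pn; exists (flip a v); rewrite !inE eqxx.
- move=> [[v a] b] /freeP[[ab at_ bt _ _]|[-> tb _]].
    by rewrite !inE ![apex v == _]eq_sym !flip_apex // negb_or; apply/andP; split; apply/eqP.
  by rewrite !inE ![apex v == _]eq_sym !flip_apex // orbb; apply/eqP; lia.
move=> [[v a] b] t /freeP[[ab at_ bt vb key]|[-> tb key]] St abt high.
- rewrite key in high; have E := free_edge_cone n2 ab at_ bt vb St abt high.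
  rewrite /free_apex E key; split.
    split; first by apply: triangle_coned => //; lia.
    move=> [[u c] d] /criticalP[cd ct dt ud] /= tE.
    have [uv _ db] := triangle_eq (idx_le a) (idx_le b) (idx_le c) (idx_le d)
      ab at_ bt cd ct dt tE.
    by move: ud; rewrite uv db (negbTE vb).
  move=> [[u c] d] jf le ji /fintype.subsetP sub; exfalso.
  have sub' w : w \in edge u c d -> exists2 x, x <= n & w = flip x v /\
      [\/ x = top v, x = a | x = b].
    move=> /sub; rewrite in_triangle => /or3P[] /eqP ->.
    + by exists (top v) => //; split; [|constructor 1].
    + by exists (nat_of_ord a) => //; split; [|constructor 2].
    + by exists (nat_of_ord b) => //; split; [|constructor 3].
  have [|x xn [Ec cx]] := sub' (flip c u); first by rewrite !inE eqxx.
  have [|y yn [Ed dy]] := sub' (flip d u); first by rewrite !inE eqxx orbT.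
  have [[cd ct dt ud ukey]|[cd td ukey]] := freeP jf; last first.
    have [|[uv dy']] := free_higher jf cd yn Ed; first by move: le; rewrite ukey; lia.
    by move: le; rewrite ukey uv; lia.
  have xy : x <> y.
    by move=> xy; rewrite xy -Ed in Ec; have := flip_inj (idx_le c) (idx_le d) Ec; lia.
  have [[uv cx' dy']|[uE cy dx]] := edge_in_ball (idx_le c) (idx_le d) xn yn xy Ec Ed.
    rewrite uv in ct dt ji *; move/eqP: ji; apply.
    by congr (_, _, _); apply: val_inj => /=; case: cx; case: dy; lia.
  (* The center [u] of the second edge lacks bit d, so v = u + e_c + e_d has it. Then [u] has
     smaller rank than [v], against the order of the keys. *)
  have vd : bit v d.
    move: ud; rewrite uE !bit_flip // eqxx (ltn_eqF cd) /=.
    by case: (bit v d) => //=; lia.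
  have := @rank_flip2_bit c d v _ vd; rewrite -uE cd idx_le => /(_ isT).
  by move: le; rewrite ukey; lia.
- rewrite key in high; have bvt : flip b v \in t.
    by move/fintype.subsetP: abt; apply; rewrite !inE eqxx.
  have E := free_vertex_cone (idx_le b) tb St bvt high.
  rewrite /free_apex E key; split.
    apply: spine_small; first exact: edge_face.
    by rewrite cards2; case: (_ == _).
  move=> [[u c] d] jf le ji /fintype.subsetP sub.
  have sub' w : w \in edge u c d -> exists2 x, x <= n & w = flip x v /\
      (x = top v \/ x = b).
    move=> /sub; rewrite in_set2 => /orP[] /eqP ->.
    + by exists (top v) => //; split; [|left].
    + by exists (nat_of_ord b) => //; split; [|right].
  have [|x xn [Ec cx]] := sub' (flip c u); first by rewrite !inE eqxx.
  have [|y yn [Ed dy]] := sub' (flip d u); first by rewrite !inE eqxx orbT.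
  have [[cd ct dt ud ukey]|[cd td ukey]] := freeP jf; last first.
    have [|[uv dy']] := free_higher jf cd yn Ed; first by move: le; rewrite ukey; lia.
    exfalso; move/eqP: ji; apply; rewrite uv in td *; rewrite cd.
    have db : d = b by apply: val_inj => /=; case: dy; lia.
    by rewrite db.
  exfalso; have xy : x <> y.
    by move=> xy; rewrite xy -Ed in Ec; have := flip_inj (idx_le c) (idx_le d) Ec; lia.
  have [[uv cx' dy']|[uE cy dx]] := edge_in_ball (idx_le c) (idx_le d) xn yn xy Ec Ed.
    rewrite uv in ct dt; case: cx; case: dy; lia.
  have db : nat_of_ord d = b by case: cx; case: dy; lia.
  (* As b exceeds [top v], the flipped center [u] does have bit b, which a free edge excludes. *)
  move: ud; rewrite uE !bit_flip // eqxx (ltn_eqF cd) /=.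
  have -> : bit v d = false by apply/negbTE/negP => /bit_top_le; lia.
  by lia.
Qed.

(** A vertex [w] other than the origin is a free vertex with center [apex w], because erasing the
    highest bit lowers [top]. *)
Lemma avoid_free t : avoid spine free_face free t -> t = [set origin]%SET.
Proof.
move=> [[[[t0 _] _] _] tP]; have tz w : w \in t -> w = origin.
  move=> wt; apply/eqP; rewrite -top_eq0 -leqn0 leqNgt; apply/negP => w0.
  pose u := flip (top w) w.
  have tu : top u < top w.
    rewrite ltnNge; apply/negP => le; have u0 : 0 < top u by lia.
    have := bit_top u0; rewrite {1}/u bit_flip // w0 andbT.
    move: le; rewrite leq_eqVlt => /orP[/eqP <-|lt].
      by rewrite eqxx bit_top.
    by rewrite (ltn_eqF lt) addbF => /bit_top_le; lia.
  have [j [jf jE _]] := free_vertex (top_le w) tu.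
  by have := tP j jf; rewrite jE /u flipK // finset.sub1set wt.
apply/setP => w; rewrite inE; apply/idP/eqP => [/tz//|->].
by case/set0Pn: t0 => u ut; rewrite -(tz u ut).
Qed.

End cube_bits.

(** * The faces of the Cech complex *)

Section cech_two.
Variables (R : realType) (G : connected_graph).
Local Notation X := (graph_space R G).
Local Notation pt := (graph_point R).
Implicit Types (u v w z : G) (x y : X).

Lemma graph_spaceP x : [/\ forall v, 0 <= val x v, \sum_v val x v = 1
  & graph_face [set v | val x v != 0]%SET].
Proof. exact: (@set_valP _ (@realization_set R G (graph_complex G)) x). Qed.

Lemma graph_pointE v w : val (pt v) w = (w == v)%:R.
Proof. by []. Qed.

Lemma supp_pair x u w : adj u w -> [set z | val x z != 0]%SET \subset [set u; w]%SET ->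
  forall f : G -> R, \sum_z val x z * f z = val x u * f u + (1 - val x u) * f w.
Proof.
move=> uw /fintype.subsetP sub f; have [_ x1 _] := graph_spaceP x.
have wu : w != u by apply: contraTneq uw => ->; rewrite adj_irr.
have x0 z : z != u -> z != w -> val x z = 0.
  move=> zu zw; apply/eqP; apply: contraT => xz.
  by have := sub z; rewrite !inE (negbTE zu) (negbTE zw) => /(_ xz).
have sum2 (g : G -> R) : (forall z, z != u -> z != w -> g z = 0) ->
    \sum_z g z = g u + g w.
  move=> g0; rewrite (bigD1 u) //= (bigD1 w) //= big1 ?addr0 // => z /andP[zu zw].
  exact: g0.
have -> : 1 - val x u = val x w by rewrite -x1 sum2 // addrAC subrr add0r.
by rewrite sum2 // => z zu zw; rewrite x0 // mul0r.
Qed.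

(** On an edge the affine extension of [f] has slope at most 1 in absolute value. Test functions of
    this kind bound distances from below. *)
Lemma edge_path_lipschitz (f : G -> R) x y l :
  (forall u w, adj u w -> `|f u - f w| <= 1) -> edge_path x y l ->
  `|\sum_v val x v * f v - \sum_v val y v * f v| <= l.
Proof.
move=> lip; elim => {x y l} [x|u w x y z l [uw sx] [_ sy] _ IHl].
  by rewrite subrr normr0.
apply: le_trans (ler_distD (\sum_v val y v * f v) _ _) _; apply: lerD => //.
rewrite (supp_pair uw sx) (supp_pair uw sy).
rewrite (_ : _ - _ = (val x u - val y u) * (f u - f w)); last by ring.
by rewrite normrM ler_piMr // lip.
Qed.

Lemma edge_path_ge0 x y l : edge_path x y l -> 0 <= l.
Proof. by elim=> {x y l} [x|u v x y z l _ _ _ l0]; rewrite ?addr_ge0. Qed.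

Lemma edge_path_trans x y (z : X) l m :
  edge_path x y l -> edge_path y z m -> edge_path x z (l + m).
Proof.
elim=> {x y l} [x|u v x y y' l xe ye _ IHl] zm; first by rewrite add0r.
by rewrite -addrA; apply: edge_pathS xe ye _; exact: IHl.
Qed.

Lemma graph_point_on_edge u v : adj u v -> on_edge u v (pt u) /\ on_edge u v (pt v).
Proof.
by move=> uv; do 2!split => //; apply/fintype.subsetP => w;
  rewrite !inE graph_pointE pnatr_eq0 eqb0 negbK => ->; rewrite ?orbT.
Qed.

(** Connectedness enters here. The infimum of an empty set of lengths would be 0, so a lower bound
    on [graph_dist] requires some path. *)
Lemma edge_path_exists v x : exists l, edge_path (pt v) x l.
Proof.
have conn u : exists l, edge_path (pt v) (pt u) l.
  have /connectP[p pv ->] := adj_connected v u.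
  elim: p v pv => [|w p IHp] v' /=; first by exists 0; exact: edge_path0.
  move=> /andP[vw wp]; have [l lw] := IHp w wp.
  have [ev ew] := graph_point_on_edge vw.
  by eexists; exact: edge_pathS ev ew lw.
have [_ x1 [[u sx]|[u [w [uw sx]]]]] := graph_spaceP x; have [l lu] := conn u.
  have -> : x = pt u; last by exists l.
  apply: val_inj; apply/funext => w; rewrite graph_pointE.
  have x0 z : z != u -> val x z = 0.
    move=> zu; apply/eqP; apply: contraT => xz.
    by move/setP: sx => /(_ z); rewrite !inE xz (negbTE zu).
  have [->|/x0 -> //] := eqVneq w u.
  by rewrite -x1 (bigD1 u) //= big1 ?addr0 // => z /x0.
have [eu _] := graph_point_on_edge uw.
have ex : on_edge u w x by split; rewrite // sx.
exists (l + (`|val (pt u) u - val x u| + 0)).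
by apply: edge_path_trans lu _; apply: edge_pathS eu ex _; exact: edge_path0.
Qed.

Lemma graph_dist_ge (f : G -> R) v x :
  (forall u w, adj u w -> `|f u - f w| <= 1) -> f v = 0 ->
  \sum_w val x w * f w <= graph_dist (pt v) x.
Proof.
move=> lip fv; apply: lb_le_inf; first exact: edge_path_exists.
move=> l /(edge_path_lipschitz lip); rewrite distrC; apply: le_trans.
rewrite [X in _ - X](_ : _ = 0) ?subr0 ?ler_norm //.
rewrite (bigD1 v) //= fv mulr0 add0r big1 // => w wv.
by rewrite (negbTE wv) mul0r.
Qed.

(* A common point of unit balls forces them all to be centered in the closed
   neighborhood of any vertex of its carrier. *)
Lemma cech2_face (s : {set G}) : cech_face (2 : R) s <->
  s != finset.set0 /\ exists u, forall v, v \in s -> v = u \/ adj u v.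
Proof.
split=> [[s0 [x sx]]|[s0 [u su]]]; split => //.
  have [x0 x1 gx] := graph_spaceP x.
  have [u [xu near]] : exists u, val x u != 0 /\
      forall w, val x w != 0 -> w = u \/ adj u w.
    case: gx => [[u sE]|[u [w [uw sE]]]]; exists u; move/setP: sE => sE.
      split; first by have := sE u; rewrite !inE eqxx.
      by move=> z xz; have := sE z; rewrite !inE xz => /esym/eqP; left.
    split; first by have := sE u; rewrite !inE eqxx.
    move=> z xz; have := sE z; rewrite !inE xz => /esym/orP[]/eqP ->; by [left|right].
  exists u => v /sx; rewrite /graph_ball /= divff ?pnatr_eq0 // => dvx.
  apply: contrapT => /not_orP[vu /negP uv].
  (* The distance from [v], truncated at 2. It is 2 at [u] and at least 1 on the carrier of [x], so
     its affine extension at [x] is at least [1 + val x u], which exceeds the radius 1. *)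
  pose f w : R := if w == v then 0 else if adj v w then 1 else 2.
  have lip z w : adj z w -> `|f z - f w| <= 1.
    move=> zw; rewrite /f; have [zv|zv] := eqVneq z v; have [wv|wv] := eqVneq w v.
    - by rewrite zv wv adj_irr in zw.
    - by rewrite zv in zw; rewrite zw sub0r normrN normr1.
    - by rewrite wv adj_sym in zw; rewrite zw subr0 normr1.
    - by rewrite ler_norml; case: ifP => _; case: ifP => _; lra.
  have fv : f v = 0 by rewrite /f eqxx.
  have fu : f u = 2.
    rewrite /f adj_sym (negbTE uv); case: eqP => // uv'.
    by case: vu.
  have := le_trans (graph_dist_ge x lip fv) dvx; apply/negP; rewrite -ltNge.
  have fge w : val x w != 0 -> 1 <= f w.
    move=> /near wu; rewrite /f; case: eqP => [wv|_]; last by case: ifP => _; lra.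
    by case: wu => uw; rewrite wv in uw; [case: vu|rewrite uw in uv].
  apply: (@lt_le_trans _ _ (1 + val x u)); first by rewrite ltrDl lt_def xu x0.
  rewrite -x1 (bigD1 u) //= [leRHS](bigD1 u) //= fu.
  have : \sum_(i | i != u) val x i <= \sum_(i | i != u) val x i * f i.
    apply: ler_sum => w _; have [->|xw] := eqVneq (val x w) 0; first by rewrite mul0r.
    by rewrite ler_peMr // fge.
  by lra.
exists (pt u) => v /su vu; rewrite /graph_ball /= divff ?pnatr_eq0 //.
case: vu => [->|uv]; first by apply: le_trans (graph_dist_xx _) _; exact: ler01.
apply: ge_inf; first by exists 0 => l /edge_path_ge0.
have [eu ev] := graph_point_on_edge uv.
have := edge_pathS ev eu (edge_path0 (pt u)).
have vu : (u == v) = false by apply/negbTE; apply: contraTneq uv => ->; rewrite adj_irr.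
by rewrite !graph_pointE eqxx vu sub0r normrN normr1 addr0.
Qed.

End cech_two.

Lemma cube_adjP n (u v : n.-tuple bool) : (v = u \/ cube_adj u v) <-> v \in ball u.
Proof.
split=> [[->|/cards1P[i uv]]|/ballP[[|a] an ->]].
- by rewrite -{1}[u]flip0 flip_ball.
- apply/ballP; exists i.+1 => //; apply: eq_from_tnth => j; rewrite tnth_mktuple.
  move/setP: uv => /(_ j); rewrite !inE eqSS val_eqE [i == j]eq_sym.
  by case: (tnth u j); case: (tnth v j); case: (j == i).
- by left; rewrite flip0.
- right; apply/cards1P; exists (Ordinal an); apply/setP => j.
  rewrite !inE tnth_mktuple eqSS -val_eqE /= [a == _]eq_sym.
  by case: (tnth u j); case: (_ == a).
Qed.

Lemma cech_hypercube_face (R : realType) n (h : 0 <= (2 : R)) :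
  face (cech (hypercube n) 2 h) = @ball_face n.
Proof.
apply/seteqP; split => s /=.
  move=> /cech2_face[s0 [u su]]; split => //; exists u.
  by apply/fintype.subsetP => v /su /cube_adjP.
move=> [s0 [u /fintype.subsetP su]]; apply/cech2_face; split => //; exists u.
by move=> v /su /cube_adjP.
Qed.

(** * The number of critical triangles *)

Section count.
Variable n : nat.
Local Notation V := (n.-tuple bool).
Local Open Scope nat_scope.

Lemma top_flip_lt (v : V) b : 0 < b -> top v < b <= n -> bit (flip b v) b /\ top (flip b v) <= b.
Proof.
move=> b0 /andP[vb bn]; split.
  rewrite bit_flip // eqxx b0 /=.
  by rewrite (_ : bit v b = false) //; apply/negbTE/negP => /bit_top_le; lia.
rewrite leqNgt; apply/negP => lt; have t0 : 0 < top (flip b v) by lia.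
have := bit_top t0; rewrite bit_flip // (ltn_eqF lt) addbF => /bit_top_le; lia.
Qed.

Lemma top_flip_gt (v : V) b : bit v b -> top v <= b -> top (flip b v) < b.
Proof.
move=> vb tb; have bn := bit_le vb; have b0 : 0 < b by case: b vb {tb bn}.
rewrite ltnNge; apply/negP => le; have t0 : 0 < top (flip b v) by lia.
have := bit_top t0; rewrite bit_flip //; have [<-|ne] := eqVneq b (top (flip b v)).
  by rewrite vb b0.
by rewrite addbF => /bit_top_le; move/eqP: ne; lia.
Qed.

Lemma flip_injective b : b <= n -> injective (@flip n b).
Proof. by move=> bn; apply: can_inj => v; exact: flipK. Qed.

Lemma bit_top_flip b : 0 < b <= n ->
  [set v : V | bit v b & top v <= b]%SET = [set flip b v | v in [set v | top v < b]]%SET.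
Proof.
move=> /andP[b0 bn]; apply/setP => v; rewrite inE; apply/andP/imsetP.
  move=> [vb tb]; exists (flip b v); last by rewrite flipK.
  by rewrite inE top_flip_gt.
move=> [w]; rewrite inE => wb ->; apply: top_flip_lt => //.
by rewrite wb bn.
Qed.

Lemma card_top_le b : b <= n -> #|[set v : V | top v <= b]%SET| = 2 ^ b.
Proof.
elim: b => [_|b IHb bn].
  rewrite (_ : [set v | _]%SET = [set origin n]%SET) ?cards1 //.
  by apply/setP => v; rewrite !inE leqn0 top_eq0.
have -> : [set v : V | top v <= b.+1]%SET =
    ([set v | top v <= b] :|: [set v | bit v b.+1 & top v <= b.+1])%SET.
  apply/setP => v; rewrite !inE; apply/idP/orP; last by case=> [|/andP[]//]; lia.
  rewrite leq_eqVlt => /orP[/eqP tb|]; last by left.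
  by right; rewrite tb eqxx andbT -tb bit_top // tb.
rewrite cardsU (_ : _ :&: _ = finset.set0)%SET; last first.
  apply/setP => v; rewrite !inE; apply/negbTE/negP => /and3P[tb vb _].
  by have := bit_top_le vb; lia.
rewrite cards0 subn0 bit_top_flip // card_imset; last exact: flip_injective.
by rewrite IHb 1?ltnW // expnS mul2n addnn.
Qed.

Lemma card_bit b : 0 < b <= n -> #|[set v : V | bit v b]%SET| = 2 ^ n.-1.
Proof.
move=> /andP[b0 bn].
have E : #|[set v : V | bit v b]%SET| = #|~: [set v : V | bit v b]%SET|.
  rewrite -(card_imset _ (flip_injective bn)); apply: eq_card => v; rewrite !inE.
  apply/imsetP/idP => [[w + ->]|vb].
    by rewrite inE => wb; rewrite bit_flip // wb eqxx b0.
  exists (flip b v); last by rewrite flipK.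
  by rewrite inE bit_flip // (negbTE vb) eqxx b0.
have := cardsC [set v : V | bit v b]%SET; rewrite -E card_tuple card_bool addnn.
have -> : 2 ^ n = (2 ^ n.-1).*2 by rewrite -mul2n -expnS prednK //; lia.
exact: double_inj.
Qed.

(** Half of all vectors have bit b, and 2^(b-1) of these have b as highest bit. The additive form
    avoids truncated subtraction. *)
Lemma card_bit_lt_top b : 0 < b <= n ->
  #|[set v : V | bit v b & b < top v]%SET| + 2 ^ b.-1 = 2 ^ n.-1.
Proof.
move=> bn; rewrite -(card_bit bn).
have -> : 2 ^ b.-1 = #|[set v : V | bit v b & top v <= b]%SET|.
  rewrite bit_top_flip // card_imset; last by apply: flip_injective; case/andP: bn.
  rewrite -card_top_le; last by lia.
  by apply: eq_card => v; rewrite !inE; lia.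
rewrite -[RHS](cardsID [set v : V | b < top v]%SET); congr (_ + _); apply: eq_card => v.
  by rewrite !inE.
by rewrite !inE -leqNgt andbC.
Qed.

(** For given [v] and b the index a ranges over 0, ..., b - 1, with 0 included, whence the factor
    b. *)
Lemma card_critical_sum : #|critical n| =
  \sum_(b < n.+1) b * #|[set v : V | bit v b & b < top v]%SET|.
Proof.
rewrite -sum1_card big_mkcond /=.
rewrite (eq_bigr (fun i : V * 'I_n.+1 * 'I_n.+1 =>
  (i.1.2 < i.2) * (bit i.1.1 i.2 && (i.2 < top i.1.1)))); last first.
  move=> [[v a] b] _ /=; rewrite inE.
  by case: (a < b); case: (bit v b); case: (b < top v).
rewrite -(pair_bigA _ (fun (i : V * 'I_n.+1) (b : 'I_n.+1) =>
  (i.2 < b) * (bit i.1 b && (b < top i.1)))) /= exchange_big /=.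
apply: eq_bigr => b _.
rewrite -(pair_bigA _ (fun (v : V) (a : 'I_n.+1) =>
  (a < b) * (bit v b && (b < top v)))) /=.
transitivity (\sum_(v : V) b * (bit v b && (b < top v))).
  apply: eq_bigr => v _; rewrite -big_distrl /=; congr (_ * _).
  rewrite (eq_bigr (fun a : 'I_n.+1 => if a < b then 1 else 0)); last first.
    by move=> a _; case: ltnP.
  have bn : b <= n.+1 by rewrite ltnW.
  by rewrite -big_mkcond /= -(big_ord_widen n.+1 (fun=> 1) bn) sum1_card card_ord.
rewrite -big_distrr /= -sum1_card [in RHS]big_mkcond /=; congr (_ * _).
by apply: eq_bigr => v _; rewrite inE; case: (_ && _).
Qed.

Lemma card_critical : 2 <= n ->
  #|critical n| = 2 ^ (n - 2) * (n ^ 2 + 4 - 3 * n) - 1.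
Proof.
(* The number is the sum over b of b (2^(n-1) - 2^(b-1)); [S2] evaluates the subtracted sum to (n -
   1) 2^n + 1 and [S1] the other one to 2^(n-2) n (n + 1). *)
move=> n2; have E : #|critical n| + \sum_(b < n.+1) b * 2 ^ b.-1 =
    \sum_(b < n.+1) b * 2 ^ n.-1.
  rewrite card_critical_sum -big_split /=; apply: eq_bigr => b _.
  have [->//|b0] := posnP b; rewrite -mulnDr card_bit_lt_top // b0 -ltnS.
  exact: ltn_ord.
have S2 m : \sum_(b < m.+1) b * 2 ^ b.-1 + 2 ^ m = m * 2 ^ m + 1.
  elim: m => [|m IHm]; first by rewrite big_ord_recl big_ord0.
  rewrite big_ord_recr /= expnS; move: IHm.
  by move: (\sum_(b < m.+1) _) (2 ^ m) => s e IHm; rewrite mulSn mulnCA mulSn; lia.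
have S1 m : 2 * \sum_(b < m.+1) b = m * m.+1.
  elim: m => [|m IHm]; first by rewrite big_ord_recl big_ord0.
  by rewrite big_ord_recr /= mulnDr IHm; lia.
move: E (S2 n) (S1 n); rewrite -big_distrl /=; move: #|_| => c.
(* With n = m + 2 the factor n^2 - 3n + 4 becomes m^2 + m + 2, free of subtraction. *)
have [m nE] : exists m, n = m.+2 by exists (n - 2); lia.
rewrite nE (_ : m.+2 - 2 = m); last by lia.
rewrite (_ : m.+2 ^ 2 + 4 - 3 * m.+2 = m * m + m + 2); last by rewrite -mulnn; nia.
rewrite [m.+2.-1]/= !expnS; move: (\sum_(b < _) _) (\sum_(b < _) _) => s1 s2.
have e0 : 0 < 2 ^ m by rewrite expn_gt0.
move: (2 ^ m) e0 => e e0 H3 H2 H1.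
have : 2 * e * s1 = e * (m.+2 * m.+3) by rewrite -H1; lia.
nia.
Qed.

End count.

(** * The homotopy type of the Čech complex of the cube *)

Lemma critical_gt0 n : (2 <= n)%N -> (0 < #|critical n|)%N.
Proof.
move=> n2; rewrite card_critical //.
have : (1 <= 2 ^ (n - 2))%N by rewrite expn_gt0.
have : (2 <= n ^ 2 + 4 - 3 * n)%N by rewrite -mulnn; nia.
nia.
Qed.

Theorem theorem4p1 (R : realType) (n : nat) (hn : (2 <= n)%N) :
  homotopy_equivalent R
    (realization R (cech (hypercube n) 2%R (Num.Theory.ler0n R 2)))
    (wedge_spheres R (2 ^ (n - 2) * (n ^ 2 + 4 - 3 * n) - 1)%N 2).
Proof.
rewrite -card_critical //.
pose idx i := enum_val (A := critical n) i.
pose p i := apex (idx i).1.1.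
pose q i := flip (idx i).1.2 (idx i).1.1.
pose r i := flip (idx i).2 (idx i).1.1.
have triE i : tri p q r i = triangle_of (idx i).
  by rewrite /tri /p /q /r; case: (idx i) => -[].
have idxP i : idx i \in critical n by exact: enum_valP.
pose e : {ptws n.-tuple bool -> R} := fun w => (w == (origin n))%:R.
have geomE : geom (avoid (@spine n) (@free_face n) (@free n)) `<=` [set e].
  move=> x [x0 x1 /avoid_free/setP sx]; apply/funext => w; rewrite /e.
  have [->|wz] := eqVneq w (origin n).
    rewrite -x1 (bigD1 (origin n)) //= big1 ?addr0 // => u uz.
    by apply/eqP; have := sx u; rewrite !inE (negbTE uz) => /negbFE.
  by apply/eqP; have := sx w; rewrite !inE (negbTE wz) => /negbFE.
have spine0 : spine [set (origin n)]%SET.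
  apply: spine_small; last by rewrite cards1.
  split; first by apply/set0Pn; exists (origin n); rewrite inE.
  by exists (origin n); rewrite finset.sub1set; apply/ballP; exists 0%N; rewrite ?flip0.
have geom_e : geom (@spine n) e.
  split => [w||]; first exact: ler0n.
    rewrite (bigD1 (origin n)) //= /e eqxx big1 ?addr0 // => w.
    by move=> /negbTE ->.
  rewrite (_ : supp e = [set (origin n)]%SET) //; apply/setP => w.
  by rewrite !inE pnatr_eq0 eqb0 negbK.
have retE : retracts (geom (@spine n)) [set e].
  have ret := @retracts_spine n R hn; have [H [_ _ _ H1 _]] := ret.
  rewrite (_ : [set e] = geom (avoid (@spine n) (@free_face n) (@free n))) //.
  (* By [geomE] the target contains no point other than [e]; it is not empty because it contains the
     image of [e] at time 1. *)
  apply/seteqP; split => // x ->; have He := H1 _ geom_e.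
  by rewrite -[X in geom _ X](geomE _ He).
apply: (@attach_triangles_wedge R _ _ (@spine n) (@coned n) p q r _ _ _ _ _ _ _ _ e).
- exact/avoid_closed/ball_face_closed.
- move=> t; split => [Ct|[[]//|[i ->]]]; last first.
    rewrite triE; have := idxP i; case: (idx i) => -[v a] b /criticalP[ab at_ bt _].
    by apply: triangle_coned => //; [exact: idx_le|exact: idx_le|lia].
  have [[i tE]|H] := pselect (exists i, t = tri p q r i); first by right; exists i.
  left; split => // j jc tE; apply: H; exists (enum_rank_in jc j).
  by rewrite triE /idx enum_rankK_in.
- by move=> i [_]; rewrite triE => /(_ _ (idxP i)).
- move=> i; have := idxP i; rewrite /p /q /r; case: (idx i) => -[v a] b /=.
  move=> /criticalP[ab at_ bt _]; rewrite !inE negb_or andbT ![apex v == _]eq_sym.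
  rewrite !flip_apex ?idx_le //; apply/andP; split; first by apply/andP; split; apply/eqP.
  by apply: flip_neq; rewrite ?idx_le //; lia.
- by move=> t; exact: coned_card.
- move=> i j; rewrite !triE => /triangle_of_inj E; apply: enum_val_inj; exact: E.
(* At least one sphere is present, so the wedge has a base point to which the spine can be sent. *)
- exact: critical_gt0.
- by rewrite cech_hypercube_face => t [].
- by rewrite cech_hypercube_face; exact: retracts_coned.
- exact: retE.
- exact: geom_e.
Qed.
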